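(* Let $((F,\nu,N),[\,,]_{F,h},(\rho,\eta))$ be a generalized Lie algebroid, with $\dim N=n$ and $\operatorname{rank}F=p$, and let $d^F$ be the exterior differentiation operator of its exterior differential $\mathcal F(N)$-algebra $(\Lambda(F,\nu,N),+,\cdot,\wedge)$. Let $(\varkappa^{1},\dots,\varkappa^{n})$ be local coordinates on an open set $U\subseteq N$ over which $F$ has a local frame $\{t_\alpha\}_{\alpha=1}^{p}$, with associated coframe $\{t^\alpha\}_{\alpha=1}^{p}$. Let $L^\alpha_{\beta\gamma}$ and $\theta^{\tilde\imath}_\alpha$ be the smooth functions on $U$ defined by $[t_\beta,t_\gamma]_{F,h}=\sum_\alpha L^\alpha_{\beta\gamma}t_\alpha$ and $\Gamma(Th\circ\rho,h\circ\eta)(t_\alpha)=\sum_{\tilde\imath}\theta^{\tilde\imath}_\alpha\frac{\partial}{\partial\varkappa^{\tilde\imath}}$. Then on $U$ the structure equations of Maurer-Cartan type hold: $$d^Ft^\alpha=-\tfrac12\sum_{\beta,\gamma=1}^{p}L^\alpha_{\beta\gamma}\,t^\beta\wedge t^\gamma,\qquad \alpha\in\{1,\dots,p\},$$ $$d^F\varkappa^{\tilde\imath}=\sum_{\alpha=1}^{p}\theta^{\tilde\imath}_\alpha\,t^\alpha,\qquad \tilde\imath\in\{1,\dots,n\}.$$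
   Context: Manifolds are smooth and finite-dimensional, vector bundles are real of finite rank; $\mathcal F(N)=C^\infty(N,\mathbb R)$, and $\Gamma(F,\nu,N)$ is the $\mathcal F(N)$-module of smooth sections of $\nu:F\to N$. For a vector bundle morphism $(\varphi,\varphi_0)$ from $(E,\pi,M)$ to $(E',\pi',M')$ with $\varphi_0$ a diffeomorphism, $\Gamma(\varphi,\varphi_0):\Gamma(E,\pi,M)\to\Gamma(E',\pi',M')$ is $\Gamma(\varphi,\varphi_0)u=\varphi\circ u\circ\varphi_0^{-1}$. A generalized Lie algebroid $((F,\nu,N),[\,,]_{F,h},(\rho,\eta))$ consists of manifolds $M,N$, diffeomorphisms $h:M\to N$ and $\eta:N\to M$, a vector bundle $(F,\nu,N)$, a vector bundle morphism $\rho:F\to TM$ covering $\eta$, and a bracket $[\,,]_{F,h}$ on $\Gamma(F,\nu,N)$ such that: (1) $[u,fv]_{F,h}=f[u,v]_{F,h}+\big(\Gamma(Th\circ\rho,h\circ\eta)(u)f\big)v$ for all sections $u,v$ and $f\in\mathcal F(N)$; (2) the bracket is $\mathbb R$-bilinear, antisymmetric and satisfies the Jacobi identity; (3) $\Gamma(Th\circ\rho,h\circ\eta):\Gamma(F,\nu,N)\to\Gamma(TN,\tau_N,N)$ is a Lie algebra morphism into vector fields on $N$. $\Lambda^q(F,\nu,N)$ is the set of alternating $\mathcal F(N)$-$q$-linear maps $\Gamma(F,\nu,N)^q\to\mathcal F(N)$, $\Lambda^0(F,\nu,N)=\mathcal F(N)$, $\Lambda(F,\nu,N)=\bigoplus_{q\ge0}\Lambda^q(F,\nu,N)$.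 The exterior product is $(\omega\wedge\theta)(z_1,\dots,z_{q+r})=\frac1{q!r!}\sum_{\sigma\in\Sigma_{q+r}}\mathrm{sgn}(\sigma)\,\omega(z_{\sigma(1)},\dots,z_{\sigma(q)})\,\theta(z_{\sigma(q+1)},\dots,z_{\sigma(q+r)})$. The exterior differentiation operator $d^F:\Lambda^q(F,\nu,N)\to\Lambda^{q+1}(F,\nu,N)$ is $$d^F\omega(z_0,\dots,z_q)=\sum_{i=0}^q(-1)^i\,\Gamma(Th\circ\rho,h\circ\eta)z_i\big(\omega(z_0,\dots,\hat z_i,\dots,z_q)\big)+\sum_{i<j}(-1)^{i+j}\omega([z_i,z_j]_{F,h},z_0,\dots,\hat z_i,\dots,\hat z_j,\dots,z_q);$$ in particular $d^Ff(z)=\Gamma(Th\circ\rho,h\circ\eta)(z)f$ for $f\in\mathcal F(N)$. The bracket, $\Gamma(Th\circ\rho,h\circ\eta)$ and $d^F$ are local and are applied to sections and forms over $U$. *)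

(* Defs.v *)
From HB Require Import structures.
From mathcomp Require Import all_boot all_order all_algebra all_fingroup.
From mathcomp Require Import all_classical all_reals all_analysis.
Set Implicit Arguments.
Unset Strict Implicit.
Unset Printing Implicit Defensive.
Import Order.TTheory GRing.Theory Num.Theory.
Import numFieldNormedType.Exports.
Local Open Scope classical_set_scope.
Local Open Scope ring_scope.

Section Smooth.
Context {R : realType}.

(* [forall x, A x -> Ck k f x] is the usual C^k condition when A is open: the
   partial derivatives of order <= k exist and are continuous on A. Asking for
   Frechet differentiability at each step does not change the class. *)
Fixpoint Ck n (k : nat) (f : 'rV[R]_n -> R) (x : 'rV[R]_n) : Prop :=
  if k is k'.+1 then
    differentiable f x /\ forall i, Ck k' ('D_('e_i) f) x
  else {for x, continuous f}.

Definition smooth n (A : set 'rV[R]_n) (f : 'rV[R]_n -> R) : Prop :=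
  forall k x, A x -> Ck k f x.

Lemma near_eq_diff (V W : normedModType R) (f g : V -> W) x :
  (\near x, f x = g x) -> differentiable f x ->
  differentiable g x /\ 'd g x = 'd f x :> (V -> W).
Proof.
move=> fg df.
have E : g \o shift x = cst (g x) + 'd f x +o_ 0 id.
  apply/eqaddoP => e e0.
  have /eqaddoP/(_ e e0) := diff_locally df.
  apply: filterS2; last first.
    move: fg; rewrite (near_shift 0) subr0; exact.
  have -> : cst (g x) = cst (f x) :> (V -> W) by rewrite (nbhs_singleton fg).
  move=> y fgy.
  have fgy' : (f \o shift x) y = (g \o shift x) y by exact: fgy.
  suff -> : (f \o shift x - (cst (f x) + 'd f x)) y
      = (g \o shift x - (cst (f x) + 'd f x)) y by [].
  by congr (_ - _).
have dE := diff_unique (diff_continuous df) E.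
split=> //; apply/diff_locallyP; split; rewrite dE //.
exact: diff_continuous.
Qed.

Lemma differentiable_rV (V : normedModType R) n (f : V -> 'rV[R]_n) x :
  (forall i, differentiable (fun y => f y 0 i) x) -> differentiable f x.
Proof.
move=> df.
have -> : f = \sum_i (fun y => f y 0 i *: 'e_i).
  by apply/funext => y; rewrite fct_sumE -row_sum_delta.
apply: differentiable_sum => i.
exact: differentiableZl.
Qed.

Lemma smooth_differentiable n (A : set 'rV[R]_n) f x :
  smooth A f -> A x -> differentiable f x.
Proof. by move=> sf Ax; have [] := sf 1%N x Ax. Qed.

Lemma smooth_continuous n (A : set 'rV[R]_n) f x :
  smooth A f -> A x -> {for x, continuous f}.
Proof. by move=> sf Ax; apply: sf 0%N x Ax. Qed.

Lemma smoothD1 n (A : set 'rV[R]_n) f i :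
  smooth A f -> smooth A ('D_('e_i) f).
Proof. by move=> sf k x Ax; have [_] := sf k.+1 x Ax; apply. Qed.

Lemma eq_near_Ck n k (f g : 'rV[R]_n -> R) x :
  (\near x, f x = g x) -> Ck k f x -> Ck k g x.
Proof.
elim: k f g x => [|k IH] f g x fg /=.
  move=> cf; suff: g @ x --> g x by [].
  rewrite -(nbhs_singleton fg); apply: cvg_trans cf.
  exact: (near_eq_cvg fg).
move=> [df Df]; split; first by have [] := near_eq_diff fg df.
move=> i; apply: IH (Df i).
by move/nbhs_interior: fg; apply: filterS => y; exact: near_eq_derive.
Qed.

Lemma eq_smooth n (A : set 'rV[R]_n) f g : open A ->
  (forall x, A x -> f x = g x) -> smooth A f -> smooth A g.
Proof.
move=> oA fg sf k x Ax; apply: eq_near_Ck (sf k x Ax).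
by apply: (filterS fg); apply: open_nbhs_nbhs.
Qed.

Lemma sub_smooth n (A B : set 'rV[R]_n) f : B `<=` A -> smooth A f -> smooth B f.
Proof. by move=> BA sf k x Bx; apply: sf; exact: BA. Qed.

Let CkA n k (A : set 'rV[R]_n) f := forall x, A x -> Ck k f x.

Let CkA_diff n k (A : set 'rV[R]_n) f x : CkA k.+1 A f -> A x -> differentiable f x.
Proof. by move=> cf Ax; have [] := cf x Ax. Qed.

Let CkA_D n k (A : set 'rV[R]_n) f i : CkA k.+1 A f -> CkA k A ('D_('e_i) f).
Proof. by move=> cf x Ax; have [_] := cf x Ax; apply. Qed.

Let eq_CkA n k (A : set 'rV[R]_n) f g : open A ->
  (forall x, A x -> f x = g x) -> CkA k A f -> CkA k A g.
Proof.
move=> oA fg sf x Ax; apply: eq_near_Ck (sf x Ax).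
by apply: (filterS fg); apply: open_nbhs_nbhs.
Qed.

Let CkAW n k (A : set 'rV[R]_n) f : CkA k.+1 A f -> CkA k A f.
Proof.
elim: k f => [|k IH] f cf x Ax.
  by apply: differentiable_continuous; exact: CkA_diff cf Ax.
split; first exact: CkA_diff cf Ax.
by move=> i; apply: IH Ax; apply: CkA_D.
Qed.

Let CkA_cst n k (A : set 'rV[R]_n) (a : R) : CkA k A (cst a).
Proof.
elim: k a => [|k IH] a x Ax.
  by apply: differentiable_continuous; exact: differentiable_cst.
split; first exact: differentiable_cst.
move=> i.
have -> : 'D_('e_i) (cst a) = cst 0 :> ('rV[R]_n -> R).
  by apply/funext => y; rewrite derive_cst.
exact: IH Ax.
Qed.

Let CkA_add n k (A : set 'rV[R]_n) f g : open A ->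
  CkA k A f -> CkA k A g -> CkA k A (f \+ g).
Proof.
move=> oA; elim: k f g => [|k IH] f g cf cg x Ax /=.
  exact: (@continuousD _ _ _ f g x (cf x Ax) (cg x Ax)).
split; first by apply: differentiableD; [exact: CkA_diff cf Ax|exact: CkA_diff cg Ax].
move=> i; move: x Ax; apply: (@eq_CkA _ k A ('D_('e_i) f \+ 'D_('e_i) g)) => //.
  move=> x Ax /=; rewrite -[f \+ g]/(f + g) deriveD //; apply: diff_derivable.
  - exact: CkA_diff cf Ax.
  - exact: CkA_diff cg Ax.
by apply: IH; apply: CkA_D.
Qed.

Let CkA_mul n k (A : set 'rV[R]_n) f g : open A ->
  CkA k A f -> CkA k A g -> CkA k A (f \* g).
Proof.
move=> oA; elim: k f g => [|k IH] f g cf cg x Ax /=.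
  exact: (@continuousM _ _ f g x (cf x Ax) (cg x Ax)).
split; first by apply: differentiableM; [exact: CkA_diff cf Ax|exact: CkA_diff cg Ax].
move=> i; move: x Ax.
apply: (@eq_CkA _ k A ((f \* 'D_('e_i) g) \+ (g \* 'D_('e_i) f))) => //.
  move=> x Ax /=; rewrite -[f \* g]/(f * g) deriveM //; apply: diff_derivable.
  - exact: CkA_diff cf Ax.
  - exact: CkA_diff cg Ax.
by apply: CkA_add => //; apply: IH; try exact: CkA_D; exact: CkAW.
Qed.

Let CkA_sum n k (A : set 'rV[R]_n) I (r : seq I) (f : I -> 'rV[R]_n -> R) : open A ->
  (forall i, CkA k A (f i)) -> CkA k A (fun x => \sum_(i <- r) f i x).
Proof.
move=> oA cf; elim: r => [|i r IH].
  by apply: (@eq_CkA _ _ _ (cst 0)) => // x _; rewrite big_nil.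
apply: (@eq_CkA _ _ _ (f i \+ (fun x => \sum_(j <- r) f j x))) => //.
  by move=> x _; rewrite big_cons.
exact: CkA_add.
Qed.

Lemma derive_comp_coord m n (f : 'rV[R]_n -> R) (g : 'rV[R]_m -> 'rV[R]_n) x v :
  differentiable f (g x) -> (forall j, differentiable (fun y => g y 0 j) x) ->
  'D_v (f \o g) x =
  \sum_j 'D_('e_j) f (g x) * 'D_v (fun y => g y 0 j) x.
Proof.
move=> df dg; have dg' := differentiable_rV dg.
rewrite deriveE; last exact: differentiable_comp.
rewrite diff_comp //= -[X in 'd f _ X]deriveE // derive_mx; last exact: diff_derivable.
set w := (\matrix_(i, j) _).
rewrite [w]row_sum_delta linear_sum /=; apply: eq_bigr => j _.
by rewrite linearZ /= -deriveE // mxE mulrC.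
Qed.

Let CkA_comp m n k (A : set 'rV[R]_m) (B : set 'rV[R]_n) f (g : 'rV[R]_m -> 'rV[R]_n) :
  open A -> open B -> (forall x, A x -> B (g x)) ->
  CkA k B f -> (forall j, smooth A (fun x => g x 0 j)) -> CkA k A (f \o g).
Proof.
move=> oA oB AB cf sg.
have dg x j : A x -> differentiable (fun y => g y 0 j) x.
  by move=> Ax; exact: smooth_differentiable (sg j) Ax.
have dg' x : A x -> differentiable g x.
  by move=> Ax; apply: differentiable_rV => j; exact: dg.
elim: k f cf => [|k IH] f cf x Ax.
  by apply: continuous_comp; [exact/differentiable_continuous/dg'|exact: (cf _ (AB _ Ax))].
split; first by apply: differentiable_comp; [exact: dg'|exact: CkA_diff cf (AB _ Ax)].
move=> i; move: x Ax.
apply: (@eq_CkA _ k A (fun x => \sum_j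
    ('D_('e_j) f \o g) x * 'D_('e_i) (fun y => g y 0 j) x)) => //.
  move=> x Ax /=; rewrite derive_comp_coord //; last by move=> j; exact: dg.
  exact: CkA_diff cf (AB _ Ax).
apply: CkA_sum => // j; apply: CkA_mul => //.
  by apply: IH; exact: CkA_D.
by move=> x; apply: smoothD1.
Qed.

Lemma smooth_cst n (A : set 'rV[R]_n) (a : R) : smooth A (cst a).
Proof. by move=> k; apply: CkA_cst. Qed.

Lemma smoothD n (A : set 'rV[R]_n) f g : open A ->
  smooth A f -> smooth A g -> smooth A (f \+ g).
Proof. by move=> oA sf sg k; apply: CkA_add => // x; [apply: sf|apply: sg]. Qed.

Lemma smoothM n (A : set 'rV[R]_n) f g : open A ->
  smooth A f -> smooth A g -> smooth A (f \* g).
Proof. by move=> oA sf sg k; apply: CkA_mul => // x; [apply: sf|apply: sg]. Qed.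

Lemma smooth_sum n (A : set 'rV[R]_n) I (r : seq I) (f : I -> 'rV[R]_n -> R) :
  open A -> (forall i, smooth A (f i)) -> smooth A (fun x => \sum_(i <- r) f i x).
Proof. by move=> oA sf k; apply: CkA_sum => // i x; apply: sf. Qed.

Lemma smooth_comp m n (A : set 'rV[R]_m) (B : set 'rV[R]_n) f
    (g : 'rV[R]_m -> 'rV[R]_n) :
  open A -> open B -> (forall x, A x -> B (g x)) ->
  smooth B f -> (forall j, smooth A (fun x => g x 0 j)) -> smooth A (f \o g).
Proof. by move=> oA oB AB sf sg k; apply: CkA_comp oA oB AB _ sg => x; apply: sf. Qed.

Lemma smooth_local n (A : set 'rV[R]_n) f :
  (forall x, A x -> exists2 V : set 'rV[R]_n, V x & smooth V f) -> smooth A f.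
Proof. by move=> H k x /H [V Vx sf]; apply: sf. Qed.

End Smooth.

Record opens (T : topologicalType) := Opens {
  opens_set :> set T;
  opens_open : open opens_set }.

Identity Coercion set_Funclass : set >-> Funclass.

Definition opensT (T : topologicalType) : opens T := Opens openT.

Definition opensI (T : topologicalType) (U V : opens T) : opens T :=
  Opens (openI (opens_open U) (opens_open V)).

(* A homeomorphism from the open set [chart_dom] onto an open subset of R^n,
   given by total functions that are unspecified outside these two sets. *)
Record chart (R : realType) (T : topologicalType) (n : nat) := Chart {
  chart_dom : set T;
  chart_map :> T -> 'rV[R]_n;
  chart_inv : 'rV[R]_n -> T;
  chart_dom_open : open chart_dom;
  chart_img_open : open (chart_map @` chart_dom);
  chart_mapK : forall x, chart_dom x -> chart_inv (chart_map x) = x;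
  chart_map_cont : forall x, chart_dom x -> {for x, continuous chart_map};
  chart_inv_cont : forall y, (chart_map @` chart_dom) y ->
    {for y, continuous chart_inv} }.

Definition chart_opens (R : realType) (T : topologicalType) (n : nat)
  (c : chart R T n) : opens T := Opens (chart_dom_open c).

Definition smooth_transition (R : realType) (T : topologicalType) (n : nat)
    (c c' : chart R T n) : Prop :=
  forall i, smooth (c @` (chart_dom c `&` chart_dom c'))
                   (fun y => c' (chart_inv c y) 0 i).

(* The smooth structure is given by an arbitrary atlas with a preferred chart
   around each point; see [maximal_atlas] below for all the local coordinates. *)
Record manifold (R : realType) (n : nat) := Manifold {
  mspace :> topologicalType;
  manifold_hausdorff : hausdorff_space mspace;
  manifold_second_countable : @second_countable mspace;
  atlas : set (chart R mspace n);
  chart_at : mspace -> chart R mspace n;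
  chart_at_atlas : forall x, atlas (chart_at x);
  chart_at_dom : forall x, chart_dom (chart_at x) x;
  atlas_smooth : forall c c', atlas c -> atlas c' -> smooth_transition c c' }.

Section Functions.
Context {R : realType} {n : nat} {M : manifold R n}.
Implicit Types (c : chart R M n) (U V W : set M) (f g : M -> R).

Definition maximal_atlas : set (chart R M n) :=
  [set c | forall c', atlas c' -> smooth_transition c c' /\ smooth_transition c' c].

Definition smooth_on U f : Prop :=
  forall c, atlas c -> smooth (c @` (chart_dom c `&` U)) (f \o chart_inv c).

Lemma atlas_maximal c : atlas c -> maximal_atlas c.
Proof. by move=> ac c' ac'; split; apply: atlas_smooth. Qed.

Lemma open_chart_image c V : open V -> open (c @` (chart_dom c `&` V)).
Proof.
move=> oV; rewrite openE => _ [x [cx Vx] <-].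
have cxI : (c @` chart_dom c) (c x) by exists x.
have h1 : nbhs (c x) (c @` chart_dom c).
  by apply: open_nbhs_nbhs; split=> //; apply: chart_img_open.
have h2 : nbhs (c x) (chart_inv c @^-1` V).
  apply: (chart_inv_cont cxI); rewrite /= chart_mapK //.
  by apply: open_nbhs_nbhs.
apply: filterS2 h1 h2 => _ [z cz <-] /=; rewrite chart_mapK // => Vz.
by exists z.
Qed.

Lemma smooth_onP U f : open U ->
  (forall x, U x -> exists c V, [/\ maximal_atlas c, open V, V x, chart_dom c x &
     smooth (c @` (chart_dom c `&` (U `&` V))) (f \o chart_inv c)]) ->
  smooth_on U f.
Proof.
move=> oU H c ac; apply: smooth_local => _ [x [cx Ux] <-].
have [c' [V [mc' oV Vx c'x sf]]] := H x Ux.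
have [_ tcc'] := mc' c ac.
have oD' := chart_dom_open c'.
exists (c @` (chart_dom c `&` (chart_dom c' `&` (U `&` V)))); first by exists x.
apply: (@eq_smooth _ _ _ ((f \o chart_inv c') \o (fun y => c' (chart_inv c y)))).
- by apply: open_chart_image; do 2 (apply: openI => //).
- by move=> _ [z [cz [c'z _]] <-] /=; rewrite (chart_mapK cz) (chart_mapK c'z).
apply: (smooth_comp (B := c' @` (chart_dom c' `&` (U `&` V)))) sf _.
- by apply: open_chart_image; do 2 (apply: openI => //).
- by apply: open_chart_image; apply: openI.
- by move=> _ [z [cz [c'z UVz]] <-] /=; rewrite (chart_mapK cz); exists z.
move=> j; apply: sub_smooth (tcc' j).
by apply: image_subset => z [cz [c'z _]].
Qed.

Lemma smooth_on_sub U V f : V `<=` U -> smooth_on U f -> smooth_on V f.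
Proof.
move=> VU sf c ac; apply: sub_smooth (sf c ac).
by apply: image_subset => x [cx /VU].
Qed.

Lemma eq_smooth_on U f g : open U -> (forall x, U x -> f x = g x) ->
  smooth_on U f -> smooth_on U g.
Proof.
move=> oU fg sf c ac; apply: eq_smooth (sf c ac); first exact: open_chart_image.
by move=> _ [x [cx Ux] <-] /=; rewrite (chart_mapK cx); apply: fg.
Qed.

Lemma smooth_on_local U f : open U ->
  (forall x, U x -> exists V, [/\ open V, V x & smooth_on (U `&` V) f]) ->
  smooth_on U f.
Proof.
move=> oU H; apply: smooth_onP => // x Ux; have [V [oV Vx sf]] := H x Ux.
exists (chart_at x), V; split => //.
- exact/atlas_maximal/chart_at_atlas.
- exact: chart_at_dom.
- exact/sf/chart_at_atlas.
Qed.

Lemma smooth_on_cst U (a : R) : smooth_on U (cst a).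
Proof. by move=> c ac; apply: smooth_cst. Qed.

Lemma smooth_onD U f g : open U ->
  smooth_on U f -> smooth_on U g -> smooth_on U (f \+ g).
Proof.
move=> oU sf sg c ac; apply: smoothD (sf c ac) (sg c ac).
exact: open_chart_image.
Qed.

Lemma smooth_onM U f g : open U ->
  smooth_on U f -> smooth_on U g -> smooth_on U (f \* g).
Proof.
move=> oU sf sg c ac; apply: smoothM (sf c ac) (sg c ac).
exact: open_chart_image.
Qed.

Lemma smooth_on_sum U I (r : seq I) (f : I -> M -> R) : open U ->
  (forall i, smooth_on U (f i)) -> smooth_on U (fun x => \sum_(i <- r) f i x).
Proof.
move=> oU sf c ac; apply: (@smooth_sum _ _ _ _ r (fun i => f i \o chart_inv c)).
  exact: open_chart_image.
by move=> i; apply: sf.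
Qed.

End Functions.
Arguments maximal_atlas {R n} M.

Section SmoothFun.
Context {R : realType} {n : nat} {M : manifold R n}.

(* The ring F(U) of smooth functions on the open set U. An element is stored as
   its extension by 0 to the whole manifold, so that equality in [smfun U] is
   equality on U; the unit is thus the indicator function of U. *)
Record smfun (U : opens M) := SmFun {
  smfun_val :> M -> R;
  smfun_smooth : smooth_on U smfun_val;
  smfun_out : forall x, ~ U x -> smfun_val x = 0 }.

Variable U : opens M.
Implicit Types f g k : smfun U.

Lemma smfunP f g : (forall x, f x = g x) -> f = g.
Proof.
case: f g => [f sf f0] [g sg g0] /= /funext fg; subst g.
by congr SmFun; apply: Prop_irrelevance.
Qed.

HB.instance Definition _ := gen_eqMixin (smfun U).
HB.instance Definition _ := gen_choiceMixin (smfun U).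

Fact smfun_restrict_subproof (f : M -> R) : smooth_on U f ->
  smooth_on U (f \_ U).
Proof.
apply: eq_smooth_on; first exact: opens_open.
by move=> x Ux; rewrite patchE mem_set.
Qed.

Definition smfun_restrict (f : M -> R) (sf : smooth_on U f) : smfun U.
Proof.
apply: (SmFun (smfun_restrict_subproof sf)) => x nUx.
by rewrite patchE memNset.
Defined.

Definition smfun_cst (a : R) : smfun U := smfun_restrict (smooth_on_cst a).

Definition smfun_add f g : smfun U.
Proof.
apply: (SmFun (smooth_onD (opens_open U) (smfun_smooth f) (smfun_smooth g))).
by move=> x nUx /=; rewrite !smfun_out // addr0.
Defined.

Definition smfun_mul f g : smfun U.
Proof.
apply: (SmFun (smooth_onM (opens_open U) (smfun_smooth f) (smfun_smooth g))).
by move=> x nUx /=; rewrite !smfun_out // mulr0.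
Defined.

Lemma smfun_cstE a x : smfun_cst a x = if x \in opens_set U then a else 0.
Proof. by rewrite /= patchE. Qed.

Lemma smfun_mul1 f : smfun_mul (smfun_cst 1) f = f.
Proof.
apply: smfunP => x; transitivity (smfun_cst 1 x * f x); first by [].
rewrite smfun_cstE; case: ifPn => [_|/negP nU]; first by rewrite mul1r.
by rewrite mul0r smfun_out // => /mem_set.
Qed.

Fact smfun_addA : associative smfun_add.
Proof. by move=> f g k; apply: smfunP => x /=; rewrite addrA. Qed.
Fact smfun_addC : commutative smfun_add.
Proof. by move=> f g; apply: smfunP => x /=; rewrite addrC. Qed.
Fact smfun_add0 : left_id (smfun_cst 0) smfun_add.
Proof.
by move=> f; apply: smfunP => x /=; rewrite patchE; case: ifP; rewrite add0r.
Qed.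
Fact smfun_addN :
  left_inverse (smfun_cst 0) (fun f => smfun_mul (smfun_cst (-1)) f) smfun_add.
Proof.
move=> f; apply: smfunP => x /=; rewrite !patchE.
case: ifPn => [_|/negP nU]; first by rewrite mulN1r addNr.
by rewrite smfun_out ?mulr0 ?addr0 // => /mem_set.
Qed.
Fact smfun_mulA : associative smfun_mul.
Proof. by move=> f g k; apply: smfunP => x /=; rewrite mulrA. Qed.
Fact smfun_mulC : commutative smfun_mul.
Proof. by move=> f g; apply: smfunP => x /=; rewrite mulrC. Qed.
Fact smfun_mulD : left_distributive smfun_mul smfun_add.
Proof. by move=> f g k; apply: smfunP => x /=; rewrite mulrDl. Qed.

HB.instance Definition _ := GRing.isZmodule.Build (smfun U)
  smfun_addA smfun_addC smfun_add0 smfun_addN.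
HB.instance Definition _ := GRing.Zmodule_isComPzRing.Build (smfun U)
  smfun_mulA smfun_mulC smfun_mul1 smfun_mulD.

Lemma smfun_addE f g x : (f + g) x = f x + g x. Proof. by []. Qed.
Lemma smfun_mulE f g x : (f * g) x = f x * g x. Proof. by []. Qed.
Lemma smfun_0E x : (0 : smfun U) x = 0.
Proof. by rewrite [LHS]smfun_cstE; case: ifP. Qed.
Lemma smfun_oneE x : U x -> (1 : smfun U) x = 1.
Proof. by move=> Ux; rewrite [LHS]smfun_cstE mem_set. Qed.
Lemma smfun_oppE f x : (- f) x = - f x.
Proof.
by apply/eqP; rewrite -addr_eq0 -smfun_addE addNr smfun_0E.
Qed.

End SmoothFun.

(* A local trivialization of the family of vector spaces E, fibre by fibre. *)
Record trivialization (R : realType) (T : topologicalType) (E : T -> lmodType R)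
    (p : nat) := Trivialization {
  triv_dom : opens T;
  triv_map : forall x, {linear E x -> 'rV[R]_p};
  triv_inv : forall x, 'rV[R]_p -> E x;
  triv_mapK : forall x, triv_dom x -> cancel (triv_map x) (triv_inv x);
  triv_invK : forall x, triv_dom x -> cancel (triv_inv x) (triv_map x) }.

(* A smooth real vector bundle of rank p: its total space is {x : M & fiber x},
   with the first projection, and its smooth structure is the one for which the
   local trivializations, whose transition matrices are smooth, are
   diffeomorphisms onto U x R^p. *)
Record vbundle (R : realType) (n : nat) (M : manifold R n) (p : nat) := VBundle {
  fiber :> M -> lmodType R;
  trivs : set (trivialization fiber p);
  trivs_cover : forall x, exists2 s, trivs s & triv_dom s x;
  trivs_smooth : forall s s', trivs s -> trivs s' -> forall j k,
    smooth_on (triv_dom s `&` triv_dom s')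
      (fun x => triv_map s' x (triv_inv s x 'e_j) 0 k) }.

Section Sections.
Context {R : realType} {n : nat} {M : manifold R n} {p : nat} (E : vbundle M p).

Definition smooth_section (U : set M) (u : forall x, E x) : Prop :=
  forall s, trivs s -> forall k,
    smooth_on (U `&` triv_dom s) (fun x => triv_map s x (u x) 0 k).

Lemma triv_invE (s : trivialization E p) x (v : 'rV[R]_p) : triv_dom s x ->
  triv_inv s x v = \sum_j v 0 j *: triv_inv s x 'e_j.
Proof.
move=> sx; apply: (can_inj (triv_mapK sx)).
rewrite triv_invK // linear_sum /= [LHS]row_sum_delta.
by apply: eq_bigr => j _; rewrite linearZ /= triv_invK.
Qed.

Lemma smooth_sectionP (U : set M) u : open U ->
  (forall x, U x -> exists s V, [/\ trivs s, open V, V x, triv_dom s x &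
    forall k, smooth_on (U `&` triv_dom s `&` V) (fun x => triv_map s x (u x) 0 k)]) ->
  smooth_section U u.
Proof.
move=> oU H s' ts' k.
have oI (s : trivialization E p) : open (U `&` triv_dom s).
  by apply: openI => //; apply: opens_open.
apply: smooth_on_local => // x [Ux s'x].
have [s [V [ts oV Vx sx su]]] := H x Ux.
have oA : open (U `&` triv_dom s' `&` (triv_dom s `&` V)).
  by apply: openI => //; apply: openI => //; apply: opens_open.
exists (triv_dom s `&` V); split=> //; first by apply: openI => //; apply: opens_open.
apply: (@eq_smooth_on _ _ _ _ (fun x => \sum_j
   (triv_map s x (u x) 0 j * triv_map s' x (triv_inv s x 'e_j) 0 k))) => //.
  move=> y [[Uy s'y] [sy Vy]].
  rewrite -[in RHS](triv_mapK sy (u y)) (triv_invE _ sy) linear_sum summxE.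
  by apply: eq_bigr => j _; rewrite linearZ mxE.
apply: smooth_on_sum => // j; apply: smooth_onM => //.
  by apply: smooth_on_sub (su j) => y [[Uy s'y] [sy Vy]].
by apply: smooth_on_sub (trivs_smooth ts ts' j k) => y [[Uy s'y] [sy Vy]].
Qed.

(* The F(U)-module of smooth sections over the open set U, stored as sections
   over M extended by 0 (as for [smfun]). *)
Record sections (U : opens M) := Sections {
  section_val :> forall x, E x;
  section_smooth : smooth_section U section_val;
  section_out : forall x, ~ U x -> section_val x = 0 }.

Variable U : opens M.
Implicit Types (u v w : sections U) (f g : smfun U).

Lemma sectionP u v : (forall x, u x = v x) -> u = v.
Proof.
case: u v => [u su u0] [v sv v0] /= uv.
have {}uv : u = v by apply: functional_extensionality_dep.
subst v.
by congr Sections; apply: Prop_irrelevance.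
Qed.

HB.instance Definition _ := gen_eqMixin (sections U).
HB.instance Definition _ := gen_choiceMixin (sections U).

Let oUs (s : trivialization E p) : open (U `&` triv_dom s).
Proof. by apply: openI; apply: opens_open. Qed.

Definition section_zero : sections U.
Proof.
apply: (@Sections _ (fun x => 0)) => // s ts k.
apply: eq_smooth_on (smooth_on_cst 0); first exact: oUs.
by move=> x _; rewrite linear0 mxE.
Defined.

Definition section_add u v : sections U.
Proof.
apply: (@Sections _ (fun x => u x + v x)) => [s ts k|x nUx]; last first.
  by rewrite !section_out // addr0.
have := smooth_onD (@oUs s) (section_smooth u ts k) (section_smooth v ts k).
by apply: eq_smooth_on => // x _; rewrite linearD mxE.
Defined.

Definition section_scale f u : sections U.
Proof.
apply: (@Sections _ (fun x => f x *: u x)) => [s ts k|x nUx]; last first.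
  by rewrite !section_out // scaler0.
have sf : smooth_on (U `&` triv_dom s) f.
  by apply: smooth_on_sub (smfun_smooth f) => x [].
have := smooth_onM (@oUs s) sf (section_smooth u ts k).
by apply: eq_smooth_on => // x _; rewrite linearZ mxE.
Defined.

Fact section_addA : associative section_add.
Proof. by move=> u v w; apply: sectionP => x /=; rewrite addrA. Qed.
Fact section_addC : commutative section_add.
Proof. by move=> u v; apply: sectionP => x /=; rewrite addrC. Qed.
Fact section_add0 : left_id section_zero section_add.
Proof. by move=> u; apply: sectionP => x /=; rewrite add0r. Qed.
Fact section_addN : left_inverse section_zero (section_scale (-1)) section_add.
Proof.
move=> u; apply: sectionP => x.
transitivity ((-1 : smfun U) x *: u x + u x); first by [].
rewrite smfun_oppE.
have [Ux|nUx] := pselect (U x); first by rewrite smfun_oneE // scaleN1r addNr.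
by rewrite section_out // scaler0 addr0.
Qed.

HB.instance Definition _ := GRing.isZmodule.Build (sections U)
  section_addA section_addC section_add0 section_addN.

Fact section_scaleA f g u :
  section_scale f (section_scale g u) = section_scale (f * g) u.
Proof. by apply: sectionP => x /=; rewrite scalerA. Qed.
Fact section_scale1 : left_id 1 section_scale.
Proof.
move=> u; apply: sectionP => x.
transitivity ((1 : smfun U) x *: u x); first by [].
have [Ux|nUx] := pselect (U x); first by rewrite smfun_oneE // scale1r.
by rewrite section_out // scaler0.
Qed.
Fact section_scaleDr : right_distributive section_scale +%R.
Proof. by move=> f u v; apply: sectionP => x /=; rewrite scalerDr. Qed.
Fact section_scaleDl u : {morph section_scale^~ u : f g / f + g}.
Proof. by move=> f g; apply: sectionP => x /=; rewrite scalerDl. Qed.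

HB.instance Definition _ := GRing.Zmodule_isLmodule.Build (smfun U) (sections U)
  section_scaleA section_scale1 section_scaleDr section_scaleDl.

Lemma section_addE u v x : (u + v) x = u x + v x. Proof. by []. Qed.
Lemma section_scaleE f u x : (f *: u) x = f x *: u x. Proof. by []. Qed.
Lemma section_zeroE x : (0 : sections U) x = 0. Proof. by []. Qed.

End Sections.

(* Vector bundle morphism covering f: fibrewise linear, and smooth on the total
   spaces, i.e. with smooth matrix coefficients in local trivializations. *)
Record bundle_mor (R : realType) (m n p q : nat) (M : manifold R m)
    (N : manifold R n) (E : vbundle M p) (E' : vbundle N q) (f : M -> N) :=
  BundleMor {
  bmor_map :> forall x, {linear E x -> E' (f x)};
  bmor_smooth : forall s s', trivs s -> trivs s' -> forall j k,
    smooth_on (triv_dom s `&` f @^-1` triv_dom s')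
      (fun x => triv_map s' (f x) (bmor_map x (triv_inv s x 'e_j)) 0 k) }.

Definition smooth_map (R : realType) (m n : nat) (M : manifold R m)
    (N : manifold R n) (f : M -> N) : Prop :=
  continuous f /\
  forall c c', atlas c -> atlas c' -> forall i,
    smooth (c @` (chart_dom c `&` f @^-1` chart_dom c'))
           (fun y => c' (f (chart_inv c y)) 0 i).

Record diffeo (R : realType) (m n : nat) (M : manifold R m) (N : manifold R n) :=
  Diffeo {
  diffeo_map :> M -> N;
  diffeo_inv : N -> M;
  diffeo_mapK : cancel diffeo_map diffeo_inv;
  diffeo_invK : cancel diffeo_inv diffeo_map;
  diffeo_map_smooth : smooth_map diffeo_map;
  diffeo_inv_smooth : smooth_map diffeo_inv }.

Lemma smooth_on_comp (R : realType) (m n : nat) (M : manifold R m)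
    (N : manifold R n) (f : M -> N) (V : set N) (g : N -> R) :
  smooth_map f -> open V -> smooth_on V g -> smooth_on (f @^-1` V) (g \o f).
Proof.
move=> [cf sf] oV sg; apply: smooth_onP; first by apply: open_comp => // x _; apply: cf.
move=> x Vfx; set c := chart_at x; set c' := chart_at (f x).
have oD : open (f @^-1` chart_dom c').
  by apply: open_comp; [move=> y _; apply: cf|exact: chart_dom_open].
have oV' : open (f @^-1` V) by apply: open_comp => // y _; apply: cf.
exists c, (f @^-1` chart_dom c'); split=> //.
- exact/atlas_maximal/chart_at_atlas.
- exact: chart_at_dom.
- exact: chart_at_dom.
have oA : open (c @` (chart_dom c `&` (f @^-1` V `&` f @^-1` chart_dom c'))).
  by apply: open_chart_image; apply: openI.
apply: (@eq_smooth _ _ _ ((g \o chart_inv c') \o (fun y => c' (f (chart_inv c y))))) => //.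
  by move=> _ [y [cy [Vy c'y]] <-] /=; rewrite (chart_mapK cy) (chart_mapK c'y).
apply: (@smooth_comp _ _ _ _ (c' @` (chart_dom c' `&` V))) => //.
- exact: open_chart_image.
- by move=> _ [y [cy [Vy c'y]] <-] /=; rewrite (chart_mapK cy); exists (f y).
- exact/sg/chart_at_atlas.
move=> j; apply: sub_smooth (sf _ _ (chart_at_atlas x) (chart_at_atlas (f x)) j).
by apply: image_subset => y [cy [_ c'y]].
Qed.

Lemma smooth_map_comp (R : realType) (l m n : nat) (L : manifold R l)
    (M : manifold R m) (N : manifold R n) (f : L -> M) (g : M -> N) :
  smooth_map f -> smooth_map g -> smooth_map (g \o f).
Proof.
move=> sf sg; split.
  by move=> x; apply: continuous_comp; [exact: sf.1|exact: sg.1].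
move=> c c' ac ac' i.
have oD : open (g @^-1` chart_dom c').
  by apply: open_comp; [move=> y _; apply: sg.1|exact: chart_dom_open].
have sc' : smooth_on (g @^-1` chart_dom c') (fun z => c' (g z) 0 i).
  move=> d ad; exact: sg.2.
exact: (smooth_on_comp sf oD sc').
Qed.

Definition diffeo_comp (R : realType) (l m n : nat) (L : manifold R l)
    (M : manifold R m) (N : manifold R n) (g : diffeo M N) (f : diffeo L M) :
  diffeo L N :=
  Diffeo (can_comp (diffeo_mapK g) (diffeo_mapK f))
    (can_comp (diffeo_invK f) (diffeo_invK g))
    (smooth_map_comp (diffeo_map_smooth f) (diffeo_map_smooth g))
    (smooth_map_comp (diffeo_inv_smooth g) (diffeo_inv_smooth f)).

Lemma bmor_expand (R : realType) (l m p q : nat) (L : manifold R l)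
    (M : manifold R m) (E : vbundle L p) (E' : vbundle M q) (f : L -> M)
    (phi : bundle_mor E E' f) (s : trivialization E p)
    x v : triv_dom s x ->
  phi x v = \sum_j triv_map s x v 0 j *: phi x (triv_inv s x 'e_j).
Proof.
move=> sx; rewrite -[in LHS](triv_mapK sx v) (triv_invE _ sx) linear_sum.
by apply: eq_bigr => j _; rewrite linearZ.
Qed.

Section BundleMor.
Context {R : realType} {l m n p q r : nat} {L : manifold R l} {M : manifold R m}
  {N : manifold R n} {E : vbundle L p} {E' : vbundle M q} {E'' : vbundle N r}.

Definition bmor_comp (f : L -> M) (g : M -> N) (psi : bundle_mor E' E'' g)
    (phi : bundle_mor E E' f) (sf : smooth_map f) (sg : smooth_map g) :
  bundle_mor E E'' (g \o f).
Proof.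
apply: (@BundleMor _ _ _ _ _ _ _ _ _ _ (fun x => psi (f x) \o phi x)).
move=> s s'' ts ts'' j k.
have oV W (h : L -> N) : continuous h -> open W -> open (h @^-1` W).
  by move=> ch oW; apply: open_comp.
have oW : open (triv_dom s `&` (g \o f) @^-1` triv_dom s'').
  apply: openI; first exact: opens_open.
  apply: oV; last exact: opens_open.
  by move=> x; apply: continuous_comp; [exact: sf.1|exact: sg.1].
apply: smooth_on_local => // x [sx s''x].
have [s' ts' s'x] := trivs_cover E' (f x).
have oS : open (f @^-1` triv_dom s').
  by apply: open_comp; [move=> y _; exact: sf.1|exact: opens_open].
exists (f @^-1` triv_dom s'); split=> //.
have oA := openI oW oS.
apply: (@eq_smooth_on _ _ _ _ (fun x => \sum_i
    triv_map s' (f x) (phi x (triv_inv s x 'e_j)) 0 i *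
    triv_map s'' (g (f x)) (psi (f x) (triv_inv s' (f x) 'e_i)) 0 k)) => //.
  move=> y [[sy s''y] s'y] /=.
  rewrite (bmor_expand psi _ s'y) linear_sum summxE.
  by apply: eq_bigr => i _; rewrite linearZ mxE.
apply: smooth_on_sum => // i; apply: smooth_onM => //.
  by apply: smooth_on_sub (bmor_smooth phi ts ts' j i) => y [[sy s''y] s'y].
have oB : open (triv_dom s' `&` g @^-1` triv_dom s'').
  apply: openI; first exact: opens_open.
  by apply: open_comp; [move=> y _; exact: sg.1|exact: opens_open].
apply: smooth_on_sub (smooth_on_comp sf oB (bmor_smooth psi ts' ts'' i k)).
by move=> y [[sy s''y] s'y].
Defined.

(* u |-> phi o u o f^-1; the cast is along f (f^-1 y) = y. *)
Definition bmor_push (f : diffeo L M) (phi : bundle_mor E E' f)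
    (u : sections E (opensT L)) : sections E' (opensT M).
Proof.
apply: (@Sections _ _ _ _ _ _ (fun y => ecast z (E' z) (diffeo_invK f y)
  (phi (diffeo_inv f y) (u (diffeo_inv f y))))) => [|x []//].
have castE (s : trivialization E' q) x z (e : f x = z) (v : E' (f x)) :
  triv_map s z (ecast z (E' z) e v) = triv_map s (f x) v by case: _ / e.
move=> s' ts' k.
have oA : open (opensT M `&` triv_dom s') by apply: openI; apply: opens_open.
apply: (@eq_smooth_on _ _ _ _
  ((fun x => triv_map s' (f x) (phi x (u x)) 0 k) \o diffeo_inv f)) => //.
  by move=> y _ /=; rewrite castE.
have oB : open (f @^-1` triv_dom s').
  by apply: open_comp; [move=> y _; exact: (diffeo_map_smooth f).1|exact: opens_open].
suff sB : smooth_on (f @^-1` triv_dom s') (fun x => triv_map s' (f x) (phi x (u x)) 0 k).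
  apply: smooth_on_sub (smooth_on_comp (diffeo_inv_smooth f) oB sB).
  by move=> y [_ s'y] /=; rewrite diffeo_invK.
apply: smooth_on_local => // x s'x.
have [s ts sx] := trivs_cover E x.
exists (triv_dom s); split=> //; first exact: opens_open.
have oC : open (f @^-1` triv_dom s' `&` triv_dom s) by apply: openI=> //; apply: opens_open.
apply: (@eq_smooth_on _ _ _ _ (fun x => \sum_i triv_map s x (u x) 0 i *
    triv_map s' (f x) (phi x (triv_inv s x 'e_i)) 0 k)) => //.
  move=> y [s'y sy]; rewrite (bmor_expand phi _ sy) linear_sum summxE.
  by apply: eq_bigr => i _; rewrite linearZ mxE.
apply: smooth_on_sum => // i; apply: smooth_onM => //.
  by apply: smooth_on_sub (section_smooth u ts i) => y [].
by apply: smooth_on_sub (bmor_smooth phi ts ts' i k) => y [].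
Defined.

End BundleMor.

Section LocalDifferential.
Context {R : realType}.

(* The differential of f at x in the charts c (around x) and c' (around f x). *)
Definition local_diff (m n : nat) (M : manifold R m) (N : manifold R n)
    (f : M -> N) (c : chart R M m) (c' : chart R N n) (x : M) :
    {linear 'rV[R]_m -> 'rV[R]_n} :=
  'd (fun y => c' (f (chart_inv c y)) : 'rV[R]_n) (c x).

Definition coord_change (n : nat) (M : manifold R n) (c c' : chart R M n) (x : M) :
    {linear 'rV[R]_n -> 'rV[R]_n} := local_diff id c c' x.

Lemma local_diff_comp (l m n : nat) (L : manifold R l) (M : manifold R m)
    (N : manifold R n) (f : L -> M) (g : M -> N) (c : chart R L l)
    (c' : chart R M m) (c'' : chart R N n) x v :
  {for x, continuous f} ->
  chart_dom c x -> chart_dom c' (f x) ->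
  differentiable (fun y => c' (f (chart_inv c y)) : 'rV[R]_m) (c x) ->
  differentiable (fun y => c'' (g (chart_inv c' y)) : 'rV[R]_n) (c' (f x)) ->
  local_diff g c' c'' (f x) (local_diff f c c' x v) = local_diff (g \o f) c c'' x v.
Proof.
move=> cf cx c'fx df dg; rewrite /local_diff.
set F := (fun y => c' (f _) : 'rV[R]_m) in df *.
set G := (fun y => c'' (g (chart_inv c' y)) : 'rV[R]_n) in dg *.
have FE : F (c x) = c' (f x) by rewrite /F (chart_mapK cx).
rewrite -FE in dg *.
have near_eq : \forall y \near c x, (G \o F) y = c'' (g (f (chart_inv c y))).
  have cxI : (c @` chart_dom c) (c x) by exists x.
  have ci : {for c x, continuous (chart_inv c)} := chart_inv_cont cxI.
  have cfi : {for c x, continuous (f \o chart_inv c)}.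
    by apply: continuous_comp => //; rewrite chart_mapK.
  have : \forall y \near c x, chart_dom c' (f (chart_inv c y)).
    apply: cfi; rewrite /= chart_mapK //; apply: open_nbhs_nbhs; split => //.
    exact: chart_dom_open.
  by apply: filterS => y c'y; rewrite /G /F /= chart_mapK.
have dGF : differentiable (G \o F) (c x) by exact: differentiable_comp.
have [_ ->] := near_eq_diff near_eq dGF.
by rewrite diff_comp.
Qed.

Lemma local_diff_id n (M : manifold R n) (c : chart R M n) x v : chart_dom c x ->
  coord_change c c x v = v.
Proof.
move=> cx; rewrite /coord_change /local_diff.
have near_eq : \forall y \near c x, id y = c (id (chart_inv c y)) :> 'rV[R]_n.
  have : (c @` chart_dom c) (c x) by exists x.
  move=> cxI; have := open_nbhs_nbhs (conj (@chart_img_open _ _ _ c) cxI).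
  by apply: filterS => _ [y cy <-]; rewrite /= chart_mapK.
have [_ ->] := near_eq_diff near_eq (@ex_diff _ _ _ _ _ _ _ (is_diff_id (c x))).
by rewrite diff_val.
Qed.

Lemma smooth_map_differentiable m n (M : manifold R m) (N : manifold R n)
   (f : M -> N) (c : chart R M m) (c' : chart R N n) x :
   smooth_map f -> atlas c -> atlas c' -> chart_dom c x -> chart_dom c' (f x) ->
   differentiable (fun y => c' (f (chart_inv c y)) : 'rV[R]_n) (c x).
Proof.
move=> [cf sf] ac ac' cx c'fx; apply: differentiable_rV => i.
by apply: smooth_differentiable (sf _ _ ac ac' i) _; exists x.
Qed.

Lemma transition_differentiable n (M : manifold R n) (c c' : chart R M n) x :
  smooth_transition c c' -> chart_dom c x -> chart_dom c' x ->
  differentiable (fun y => c' (id (chart_inv c y)) : 'rV[R]_n) (c x).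
Proof.
move=> t cx c'x; apply: differentiable_rV => i.
by apply: smooth_differentiable (t i) _; exists x.
Qed.

Lemma coord_changeK n (M : manifold R n) (c c' : chart R M n) x :
  smooth_transition c c' -> smooth_transition c' c ->
  chart_dom c x -> chart_dom c' x ->
  cancel (coord_change c c' x) (coord_change c' c x).
Proof.
move=> t t' cx c'x v; rewrite /coord_change.
rewrite (@local_diff_comp _ _ _ _ _ _ id id c c' c) //.
- exact: local_diff_id.
- exact: transition_differentiable.
- exact: transition_differentiable.
Qed.

Lemma coord_change_comp n (M : manifold R n) (c c' c'' : chart R M n) x v :
  smooth_transition c c' -> smooth_transition c' c'' ->
  chart_dom c x -> chart_dom c' x -> chart_dom c'' x ->
  coord_change c' c'' x (coord_change c c' x v) = coord_change c c'' x v.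
Proof.
move=> t t' cx c'x c''x.
have ct : {for x, continuous (@id M)} by [].
have dt := transition_differentiable t cx c'x.
have dt' := transition_differentiable t' c'x c''x.
have := @local_diff_comp _ _ _ _ _ _ id id c c' c'' x v ct cx c'x dt dt'.
have -> : @id M \o @id M = id by [].
exact.
Qed.

Lemma local_diff_coordE m n (M : manifold R m) (N : manifold R n)
    (f : M -> N) (c : chart R M m) (c' : chart R N n) x j k :
  differentiable (fun y => c' (f (chart_inv c y)) : 'rV[R]_n) (c x) ->
  local_diff f c c' x 'e_j 0 k =
  'D_('e_j) (fun y => c' (f (chart_inv c y)) 0 k) (c x).
Proof.
move=> df; rewrite /local_diff -deriveE // derive_mx ?mxE //.
exact: diff_derivable.
Qed.

End LocalDifferential.

Section TangentBundle.
Context {R : realType} {n : nat} (M : manifold R n).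

(* A tangent vector at x is represented by its coordinates in the preferred chart
   at x; its coordinates in any other chart c of the atlas are obtained by the
   differential of the change of charts, and these give the trivializations. *)
Definition tangent_space (x : M) : lmodType R := 'rV[R]_n.

Definition tangent_triv (c : chart R M n) (ac : atlas c) :
  trivialization tangent_space n.
Proof.
apply: (@Trivialization _ _ _ _ (chart_opens c)
  (fun x => coord_change (chart_at x) c x) (fun x => coord_change c (chart_at x) x)).
- move=> x cx; apply: coord_changeK => //; last exact: chart_at_dom.
  + exact/atlas_smooth/ac/chart_at_atlas.
  + exact/atlas_smooth/chart_at_atlas.
- move=> x cx; apply: coord_changeK => //; last exact: chart_at_dom.
  + exact/atlas_smooth/chart_at_atlas.
  + exact/atlas_smooth/ac/chart_at_atlas.
Defined.

Definition tangent_bundle : vbundle M n.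
Proof.
apply: (@VBundle _ _ _ _ tangent_space
  [set s | exists c (ac : atlas c), s = tangent_triv ac]).
- move=> x; exists (tangent_triv (chart_at_atlas x)); last exact: chart_at_dom.
  by exists (chart_at x), (chart_at_atlas x).
- move=> _ _ [c [ac ->]] [c' [ac' ->]] j k.
  have oA : open (chart_dom c `&` chart_dom c') by apply: openI; apply: chart_dom_open.
  apply: smooth_onP => // x [cx c'x].
  exists c, setT; split => //; [exact: atlas_maximal|exact: openT|].
  have t := atlas_smooth ac ac'.
  apply: (@eq_smooth _ _ _
      ('D_('e_j) (fun y => c' (chart_inv c y) 0 k))).
  + by apply: open_chart_image; apply: openI => //; exact: openT.
  + move=> _ [y [cy [[_ c'y] _]] <-] /=; rewrite (chart_mapK cy).
    rewrite coord_change_comp //; last exact: chart_at_dom.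
    * by rewrite local_diff_coordE //; exact: transition_differentiable.
    * exact/atlas_smooth/chart_at_atlas.
    * exact/atlas_smooth/ac'/chart_at_atlas.
  + apply: sub_smooth (smoothD1 j (t k)).
    by apply: image_subset => y [cy [[_ c'y] _]].
Defined.

End TangentBundle.

Definition tangent_map (R : realType) (m n : nat) (M : manifold R m)
    (N : manifold R n) (f : M -> N) (sf : smooth_map f) :
  bundle_mor (tangent_bundle M) (tangent_bundle N) f.
Proof.
apply: (@BundleMor _ _ _ _ _ _ _ (tangent_bundle M) (tangent_bundle N) f
  (fun x => local_diff f (chart_at x) (chart_at (f x)) x)).
move=> _ _ [c [ac ->]] [c' [ac' ->]] j k.
have oA : open (chart_dom c `&` f @^-1` chart_dom c').
  apply: openI; first exact: chart_dom_open.
  by apply: open_comp; [move=> y _; exact: sf.1|exact: chart_dom_open].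
apply: smooth_onP => // x [cx c'x].
exists c, setT; split => //; [exact: atlas_maximal|exact: openT|].
apply: (@eq_smooth _ _ _
    ('D_('e_j) (fun y => c' (f (chart_inv c y)) 0 k))).
+ by apply: open_chart_image; apply: openI => //; exact: openT.
+ move=> _ [y [cy [[_ c'y] _]] <-] /=; rewrite (chart_mapK cy).
  have aty := chart_at_atlas y; have atfy := chart_at_atlas (f y).
  have dy := chart_at_dom y; have dfy := chart_at_dom (f y).
  rewrite /coord_change.
  rewrite (@local_diff_comp _ _ _ _ _ _ _ id f c (chart_at y) (chart_at (f y))) //.
  - rewrite (@local_diff_comp _ _ _ _ _ _ _ f id c (chart_at (f y)) c') //.
    + by rewrite local_diff_coordE //; exact: smooth_map_differentiable.
    + exact: sf.1.
    + exact: smooth_map_differentiable.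
    + apply: transition_differentiable => //; exact: atlas_smooth.
  - apply: transition_differentiable => //; exact: atlas_smooth.
  - exact: smooth_map_differentiable.
+ apply: sub_smooth (smoothD1 j (sf.2 _ _ ac ac' k)).
  by apply: image_subset => y [cy [[_ c'y] _]].
Defined.

Section VectorFields.
Context {R : realType} {n : nat} {M : manifold R n} {U : opens M}.

Lemma diff_chart_inv (f : M -> R) (c d : chart R M n) y v :
  chart_dom c y -> chart_dom d y ->
  differentiable (f \o chart_inv c) (c y) ->
  differentiable (fun z => c (chart_inv d z) : 'rV[R]_n) (d y) ->
  'd (f \o chart_inv c) (c y) (coord_change d c y v) = 'd (f \o chart_inv d) (d y) v.
Proof.
move=> cy dy df dt.
pose F z : 'rV[R]_n := c (chart_inv d z); pose G := f \o chart_inv c.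
have FE : F (d y) = c y by rewrite /F chart_mapK.
have dG : differentiable G (F (d y)) by rewrite FE.
have near_eq : \forall z \near d y, (G \o F) z = (f \o chart_inv d) z.
  have dyI : (d @` chart_dom d) (d y) by exists y.
  have : \forall z \near d y, chart_dom c (chart_inv d z).
    apply: (chart_inv_cont dyI); rewrite /= chart_mapK //.
    by apply: open_nbhs_nbhs; split=> //; exact: chart_dom_open.
  by apply: filterS => z cz; rewrite /G /F /= chart_mapK.
have [_ E] := near_eq_diff near_eq (differentiable_comp dt dG).
transitivity ('d (G \o F) (d y) v); last exact: (esym (congr1 (fun h => h v) E)).
have -> : 'd G (c y) = 'd G (F (d y)) by rewrite FE.
exact: (esym (congr1 (fun h => h v) (diff_comp dt dG))).
Qed.

(* The derivative of the function f along the vector field X. *)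
Definition vfield_act (X : sections (tangent_bundle M) U) (f : smfun U) : smfun U.
Proof.
apply: (@SmFun _ _ _ _
  (fun x => 'd (f \o chart_inv (chart_at x)) (chart_at x x) (X x))); last first.
  by move=> x nUx; rewrite section_out // linear0.
have oU := opens_open U.
apply: smooth_onP => // x Ux; set c := chart_at x.
have ac : atlas c := chart_at_atlas x.
exists c, setT; split => //; [exact: atlas_maximal|exact: openT|exact: chart_at_dom|].
rewrite setIT.
have sX i : smooth_on (U `&` chart_dom c)
    (fun y => coord_change (chart_at y) c y (X y) 0 i).
  by apply: (@section_smooth _ _ _ _ _ U X (tangent_triv ac)); exists c, ac.
have sf := smfun_smooth f ac.
have oA : open (c @` (chart_dom c `&` U)) by exact: open_chart_image.
apply: (@eq_smooth _ _ _ (fun z => \sum_i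
   'D_('e_i) (f \o chart_inv c) z *
   coord_change (chart_at (chart_inv c z)) c (chart_inv c z) (X (chart_inv c z)) 0 i)) => //.
  move=> _ [y [cy Uy] <-] /=; rewrite (chart_mapK cy).
  set d := chart_at y; have dy : chart_dom d y := chart_at_dom y.
  have ad : atlas d := chart_at_atlas y.
  have df : differentiable (f \o chart_inv c) (c y).
    by apply: smooth_differentiable sf _; exists y.
  have dt : differentiable (fun y => c (id (chart_inv d y)) : 'rV[R]_n) (d y).
    by apply: transition_differentiable => //; exact: atlas_smooth.
  transitivity ('d (f \o chart_inv c) (c y) (coord_change d c y (X y))).
    set v := coord_change d c y (X y).
    rewrite [in RHS](row_sum_delta v) linear_sum /=.
    by apply: eq_bigr => i _; rewrite linearZ /= deriveE // mulrC.
  exact: diff_chart_inv.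
apply: smooth_sum => // i; apply: smoothM => //; first exact: smoothD1.
apply: sub_smooth (sX i c ac).
by apply: image_subset => y [].
Defined.

End VectorFields.

Section Coordinates.
Context {R : realType} {n : nat} {M : manifold R n} (c : chart R M n)
  (mc : maximal_atlas M c).
Let U := chart_opens c.

Definition coord_fun (i : 'I_n) : smfun U.
Proof.
apply: (@smfun_restrict _ _ _ _ (fun x => c x 0 i)) => d ad.
have [_ t] := mc ad; exact: t.
Defined.

(* The vector field d/dc^i on the domain of the chart c. *)
Definition coord_vfield (i : 'I_n) : sections (tangent_bundle M) U.
Proof.
apply: (@Sections _ _ _ _ (tangent_bundle M) U
  (fun x => if x \in chart_dom c then coord_change c (chart_at x) x 'e_i else 0));
  last by move=> x nUx; rewrite memNset.
move=> _ [d [ad ->]] k.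
have [t t'] := mc ad.
have oA : open (U `&` chart_dom d) by apply: openI; apply: chart_dom_open.
apply: smooth_onP => // x [cx dx].
exists c, setT; split => //; first exact: openT.
rewrite setIT.
apply: (@eq_smooth _ _ _ ('D_('e_i) (fun y => d (chart_inv c y) 0 k))).
- exact: open_chart_image.
- move=> _ [y [cy [_ dy]] <-] /=; rewrite (chart_mapK cy) mem_set //.
  have [u u'] := mc (chart_at_atlas y).
  rewrite coord_change_comp //; last exact: chart_at_dom.
  + by rewrite local_diff_coordE //; exact: transition_differentiable.
  + exact/atlas_smooth/ad/chart_at_atlas.
- apply: sub_smooth (smoothD1 i (t k)).
  by apply: image_subset => y [cy [_ dy]].
Defined.

End Coordinates.

Section Algebroid.
Context {R : realType} {m n p : nat} {M : manifold R m} {N : manifold R n}.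

(* Gamma(Th o rho, h o eta) *)
Definition anchor_op (F : vbundle N p) (h : diffeo M N) (eta : diffeo N M)
    (rho : bundle_mor F (tangent_bundle M) eta) (u : sections F (opensT N)) :
  sections (tangent_bundle N) (opensT N) :=
  @bmor_push _ _ _ _ _ _ _ _ _ (diffeo_comp h eta)
    (bmor_comp (tangent_map (diffeo_map_smooth h)) rho
       (diffeo_map_smooth eta) (diffeo_map_smooth h)) u.

(* Z = [X, Y], as derivations of F(N). *)
Definition is_lie_bracket (X Y Z : sections (tangent_bundle N) (opensT N)) :=
  forall f, vfield_act Z f = vfield_act X (vfield_act Y f) - vfield_act Y (vfield_act X f).

Record gen_lie_algebroid (F : vbundle N p) := GenLieAlgebroid {
  gla_h : diffeo M N;
  gla_eta : diffeo N M;
  gla_rho : bundle_mor F (tangent_bundle M) gla_eta;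
  bracket : sections F (opensT N) -> sections F (opensT N) -> sections F (opensT N);
  bracket_leibniz : forall u v f,
    bracket u (f *: v) =
      f *: bracket u v + vfield_act (anchor_op gla_h gla_rho u) f *: v;
  bracket_linearl : forall (a : R) u v w,
    bracket (smfun_cst _ a *: u + v) w = smfun_cst _ a *: bracket u w + bracket v w;
  bracket_linearr : forall (a : R) u v w,
    bracket u (smfun_cst _ a *: v + w) = smfun_cst _ a *: bracket u v + bracket u w;
  bracket_antisym : forall u v, bracket u v = - bracket v u;
  bracket_jacobi : forall u v w,
    bracket u (bracket v w) + bracket v (bracket w u) + bracket w (bracket u v) = 0;
  anchor_linear : forall (a : R) u v,
    anchor_op gla_h gla_rho (smfun_cst _ a *: u + v) =
      smfun_cst _ a *: anchor_op gla_h gla_rho u + anchor_op gla_h gla_rho v;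
  anchor_bracket : forall u v,
    is_lie_bracket (anchor_op gla_h gla_rho u) (anchor_op gla_h gla_rho v)
      (anchor_op gla_h gla_rho (bracket u v)) }.

End Algebroid.
Arguments gen_lie_algebroid {R m n p} M {N} F.

Section Local.
Context {R : realType} {m n p : nat} {M : manifold R m} {N : manifold R n}
  {F : vbundle N p} (G : gen_lie_algebroid M F) {U : opens N}.
Implicit Types (s t : sections F U) (u v : sections F (opensT N)).

Definition anchor u := anchor_op (gla_h G) (gla_rho G) u.

Definition agree_near u s (x : N) : Prop := \forall y \near x, u y = s y.

(* The bracket and the anchor being local operators, their value at x on sections
   over U is their value at x on any global sections with the same germs at x;
   this determines them, since every germ extends to a global section. *)
Definition local_bracket s t : sections F U :=
  xget 0 [set w : sections F U | forall x, U x -> forall u v,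
    agree_near u s x -> agree_near v t x -> w x = bracket G u v x].

Definition local_anchor s : sections (tangent_bundle N) U :=
  xget 0 [set X : sections (tangent_bundle N) U | forall x, U x -> forall u,
    agree_near u s x -> X x = anchor u x].

Definition is_frame (t : 'I_p -> sections F U) : Prop :=
  forall x, U x -> forall v : F x, exists! a : 'rV[R]_p, v = \sum_i a 0 i *: t i x.

Local Notation cochain q := (('I_q -> sections F U) -> smfun U).

(* Lambda^q over U. *)
Record ext_form (q : nat) := ExtForm {
  ext_form_val :> cochain q;
  ext_form_linear : forall z i (f : smfun U) s t,
    ext_form_val [eta z with i |-> f *: s + t] =
      f * ext_form_val [eta z with i |-> s] + ext_form_val [eta z with i |-> t];
  ext_form_alternating : forall z i j, i != j -> z i = z j -> ext_form_val z = 0 }.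

Definition ext_form0 (f : smfun U) : ext_form 0.
Proof. by apply: (@ExtForm _ (fun=> f)) => z []. Defined.

Definition ext_prod (q r : nat) (w : cochain q) (w' : cochain r) : cochain (q + r) :=
  fun z => smfun_cst U ((q`! * r`!)%:R^-1) *
    \sum_(sigma : 'S_(q + r)) (-1) ^+ sigma *
      (w (fun k => z (sigma (lshift r k))) * w' (fun k => z (sigma (rshift q k)))).

(* In the second sum the argument list of w is [z_i, z_j] followed by the z_l,
   l different from i and j, in increasing order. *)
Definition exterior_d (q : nat) (w : cochain q) : cochain q.+1 := fun z =>
  \sum_(i < q.+1) (-1) ^+ i *
     vfield_act (local_anchor (z i)) (w (fun k => z (lift i k))) +
  \sum_(i < q.+1) \sum_(j < q.+1 | (i < j)%N) (-1) ^+ (i + j) *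
     w (fun k => nth 0 (local_bracket (z i) (z j) ::
       [seq z l | l <- enum 'I_q.+1 & (l != i) && (l != j)]) k).

End Local.
Arguments ext_form {R n p N} F U q.
Arguments ext_form0 {R n p N} F {U} f.

(* Main.v *)
(* The operators on sections over U are given by their values on global sections
   with the same germs, so everything rests on two facts: every germ extends to a
   global section (smooth bump functions), and the bracket and the anchor of a
   generalized Lie algebroid are local. The bracket is local by Leibniz's rule
   applied to a section multiplied by a cut-off. The anchor a priori evaluates at x
   the value of a section at phi^-1 x, where phi = h o eta; but the two vanishing
   brackets [u, v] and [u, f v] with u = 0 near x force it to be local as well, hence
   to depend only on the value at x. Both operators then satisfy on U the same
   linearity and Leibniz rules as globally. A form of degree 1 also sees only the
   value of a section at a point, so z = sum_a t^a(z) t_a for every section z over U,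
   and expanding both arguments of dt^a in the frame gives the structure equations. *)
Require Import Defs.
From mathcomp Require Import all_boot all_order all_algebra all_fingroup.
From mathcomp Require Import all_classical all_reals all_analysis.
From mathcomp Require Import ring lra.
Set Implicit Arguments.
Unset Strict Implicit.
Unset Printing Implicit Defensive.
Import Order.TTheory GRing.Theory Num.Theory.
Import numFieldNormedType.Exports.
Local Open Scope classical_set_scope.
Local Open Scope ring_scope.

(** * Smooth bump functions *)

Section Bump.
Context {R : realType}.

(* The polynomial makes the family stable under derivation, which gives smoothness. *)
Definition flat (P : {poly R}) (x : R) : R :=
  if 0 < x then P.[x^-1] * expR (- x^-1) else 0.

(** With y = 1/x, exp y >= y^(i+1) / (i+1)! bounds y^i exp(-y) by (i+1)! x; this is summed over the
    coefficients of P. *)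
Lemma flat_bound (P : {poly R}) : exists C : R, forall x, `|flat P x| <= C * `|x|.
Proof.
exists (\sum_(i < size P) `|P`_i| * i.+1`!%:R) => x; rewrite /flat.
case: ifPn => x0; last first.
  by rewrite normr0; apply: mulr_ge0 => //; apply: sumr_ge0 => i _; apply: mulr_ge0.
rewrite horner_coef mulr_suml (le_trans (ler_norm_sum _ _ _))// mulr_suml.
apply: ler_sum => i _; rewrite !normrM -!mulrA ler_wpM2l //.
have y0 : 0 < x^-1 by rewrite invr_gt0.
rewrite !ger0_norm ?expR_ge0 ?exprn_ge0 //; [|exact: ltW..].
rewrite -ler_pdivrMr // expRN mulrAC -exprSr ler_pdivrMr ?expR_gt0 // mulrC.
rewrite -ler_pdivrMr ?ltr0n ?fact_gt0 //.
by apply: le_trans (expR_ge1Dxn i (ltW y0)); rewrite lerDr.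
Qed.

(** For x > 0, differentiating P(y) exp(-y) in y = 1/x gives (P' - P)(y) exp(-y), and dy/dx = -y^2.
    The point 0 rests on [flat_bound]. *)
Lemma flat_derive (P : {poly R}) (x : R) :
  is_derive x 1 (flat P) (flat ('X^2 * (P - P^`())) x).
Proof.
have [x0|x0|->] := ltgtP x 0.
- rewrite {2}/flat ltNge (ltW x0) /=.
  apply: (near_eq_is_derive (f := cst (0 : R))).
  near=> y; rewrite /flat ltNge ltW //.
  by near: y; exact: lt_nbhsl.
- have dV : is_derive x 1 (fun y : R => y^-1) (- x ^- 2).
    have := @is_deriveV _ (@id R) x 1 1 (lt0r_neq0 x0) (is_derive_id _ _).
    by rewrite -[_ *: 1]/(_ * 1) mulr1.
  have dN : is_derive x 1 (fun y : R => - y^-1) (x ^- 2).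
    by apply: is_derive_eq; rewrite opprK.
  have dP : is_derive x 1 (horner P \o (fun y : R => y^-1)) (P^`().[x^-1] * (- x ^- 2)).
    exact: is_derive1_comp.
  have dE : is_derive x 1 (expR \o (fun y : R => - y^-1)) (expR (- x^-1) * x ^- 2).
    exact: is_derive1_comp.
  have dPE := is_deriveM dP dE.
  rewrite {2}/flat x0.
  apply: (near_eq_is_derive (f := (horner P \o (fun y : R => y^-1)) *
                                  (expR \o (fun y : R => - y^-1)))).
  + near=> y; rewrite /flat ifT //.
    by near: y; exact: lt_nbhsr.
  apply: is_derive_eq.
  rewrite /= !hornerE -![_ *: _]/(_ * _) exprVn; ring.
- rewrite {2}/flat ltxx.
  (* For h > 0 the difference quotient at 0 is P(1/h) exp(-1/h) / h, that is [flat ('X * P) h], so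
     it is squeezed between -C |h| and C |h|. *)
  have [C HC] := flat_bound ('X * P).
  have c0 : C * `|h| @[h --> (0:R)^'] --> (0:R).
    rewrite -[X in _ --> X](mulr0 C); apply: cvgM; first exact: cvg_cst.
    rewrite -[X in _ --> X](normr0 R); apply: cvg_norm.
    exact: (@cvg_within _ (nbhs (0:R))).
  have Q0 : h^-1 *: (flat P (h *: 1 + 0) - flat P 0) @[h --> (0:R)^'] --> (0:R).
    apply: (@squeeze_cvgr _ _ _ _ (fun h => - (C * `|h|)) (fun h => C * `|h|)).
    + near=> h.
      rewrite -ler_norml; apply: le_trans (HC h); rewrite le_eqVlt; apply/orP; left; apply/eqP.
      congr (`|_|); rewrite addr0 {2}/flat ltxx subr0 -[_ *: 1]/(_ * 1) mulr1 /flat.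
      case: ifP => _; last by rewrite scaler0.
      by rewrite -[_ *: _]/(h^-1 * _) !hornerE.
    + by rewrite -[X in _ --> X]oppr0; exact: cvgN c0.
    + exact: c0.
  by apply: DeriveDef; [apply/cvg_ex; exists 0|apply/cvg_lim].
Unshelve. all: by end_near.
Qed.


(** Induction on the order of differentiability, for all members of P at once. A class stable under
    partial derivatives is thus smooth without computing any iterated derivative. *)
Lemma smooth_coind n (A : set 'rV[R]_n) (P : set ('rV[R]_n -> R)) : open A ->
  (forall f x, P f -> A x -> differentiable f x) ->
  (forall f i, P f -> exists2 g, P g & forall x, A x -> g x = 'D_('e_i) f x) ->
  forall f, P f -> smooth A f.
Proof.
move=> oA dP DP f + k; elim: k f => [|k IH] f Pf x Ax /=.
  exact: differentiable_continuous (dP _ _ Pf Ax).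
split=> [|i]; first exact: dP.
have [g Pg gE] := DP _ i Pf.
apply: eq_near_Ck (IH _ Pg _ Ax).
by apply: (filterS gE); apply: open_nbhs_nbhs.
Qed.

Lemma derive_coord n (x v : 'rV[R]_n) j : 'D_v (fun y : 'rV[R]_n => y 0 j) x = v 0 j.
Proof.
have := @derive_mx _ _ _ _ (@id 'rV[R]_n) x v (@derivable_id _ _ x v).
by rewrite derive_id => /matrixP/(_ 0 j); rewrite mxE => <-.
Qed.

Lemma smooth_coord n (A : set 'rV[R]_n) j : smooth A (fun x => x 0 j).
Proof.
move=> [|k] x Ax; first exact/differentiable_continuous/differentiable_coord.
split=> [|i]; first exact: differentiable_coord.
have -> : 'D_('e_i) (fun x : 'rV[R]_n => x 0 j) = cst (('e_i : 'rV[R]_n) 0 j).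
  by apply/funext => y; rewrite derive_coord.
exact: (@smooth_cst _ _ A).
Qed.

Lemma smooth_flat (A : set 'rV[R]_1) P : smooth A (fun x => flat P (x 0 0)).
Proof.
apply: (@sub_smooth _ _ setT) => //.
have dc (x : 'rV[R]_1) j : differentiable (fun x : 'rV[R]_1 => x 0 j) x.
  exact: differentiable_coord.
have df Q (y : R) : differentiable (flat Q) y.
  by apply/derivable1_diffP; case: (flat_derive Q y).
have dfc Q (x : 'rV[R]_1) : differentiable (fun x : 'rV[R]_1 => flat Q (x 0 0)) x.
  exact: (@differentiable_comp _ _ _ _ (fun x : 'rV[R]_1 => x 0 0) (flat Q)).
have := @smooth_coind 1 setT [set f | exists Q, f = fun x : 'rV[R]_1 => flat Q (x 0 0)] openT.
apply.
- by move=> _ x [Q ->] _.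
- move=> _ i [Q ->].
  exists (fun x => flat ('X^2 * (Q - Q^`())) (x 0 0)); first by exists ('X^2 * (Q - Q^`())).
  move=> x _; rewrite deriveE //.
  rewrite (@diff_comp _ _ _ _ (fun x : 'rV[R]_1 => x 0 0) (flat Q)) //=.
  have -> : 'd (fun x : 'rV[R]_1 => x 0 0) x 'e_i = 1.
    by rewrite -deriveE // derive_coord mxE !ord1 eqxx.
  by rewrite -deriveE //; case: (flat_derive Q (x 0 0)) => _ ->.
- by exists P.
Qed.

(** The Euclidean square distance is polynomial in the coordinates, hence smooth, unlike the sup
    norm of ['rV[R]_n]. *)
Definition scaled_sqdist n (a : 'rV[R]_n) (r : R) (y : 'rV[R]_n) : R :=
  \sum_i ((y 0 i - a 0 i) / r) ^+ 2.

(* The inner cut-off vanishes near a, and exceeds the constant [flat 1 (3 / 4)] where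
   the scaled distance is at least 1; so the quotient is 1 near a and 0 far away,
   and only a constant has to be inverted. *)
Definition box_bump n (a : 'rV[R]_n) (r : R) (y : 'rV[R]_n) : R :=
  flat 1 (flat 1 (3 / 4) - flat 1 (scaled_sqdist a r y - 1 / 4)) /
  flat 1 (flat 1 (3 / 4)).

Lemma smooth_scaled_sqdist n (A : set 'rV[R]_n) a r : open A ->
  smooth A (scaled_sqdist a r).
Proof.
move=> oA; apply: smooth_sum => // i; apply: smoothM => //.
all: apply: smoothM; [done| |exact: smooth_cst].
all: by apply: smoothD; [done|exact: smooth_coord|exact: smooth_cst].
Qed.

Lemma smooth_comp_flat n (A : set 'rV[R]_n) P (f : 'rV[R]_n -> R) : open A ->
  smooth A f -> smooth A (fun x => flat P (f x)).
Proof.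
move=> oA sf.
apply: (@eq_smooth _ _ _ ((fun x : 'rV[R]_1 => flat P (x 0 0)) \o (fun x => (f x)%:M))) => //.
  by move=> x _; rewrite /= mxE eqxx.
apply: (@smooth_comp _ _ _ A setT) => //; [exact: openT|exact: smooth_flat|].
by move=> j; apply: eq_smooth sf => // x _; rewrite mxE !ord1 eqxx.
Qed.

Lemma smooth_box_bump n (A : set 'rV[R]_n) a r : open A -> smooth A (box_bump a r).
Proof.
move=> oA; apply: smoothM => //; last exact: smooth_cst.
apply: smooth_comp_flat => //; apply: smoothD => //; first exact: smooth_cst.
apply: (@eq_smooth _ _ _ (cst (-1) \* (fun y => flat 1 (scaled_sqdist a r y - 1 / 4)))) => //.
  by move=> x _; rewrite /= mulN1r.
apply: smoothM => //; first exact: smooth_cst.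
apply: smooth_comp_flat => //; apply: smoothD => //; last exact: smooth_cst.
exact: smooth_scaled_sqdist.
Qed.

Let flat1_gt0 (x : R) : 0 < x -> 0 < flat 1 x.
Proof. by move=> x0; rewrite /flat x0 hornerC mul1r expR_gt0. Qed.

Let flat1_le (x y : R) : x <= y -> flat 1 x <= flat 1 y.
Proof.
rewrite /flat !hornerC !mul1r => xy; case: (ltP 0 x) => x0.
  by rewrite (lt_le_trans x0 xy) ler_expR lerN2 lef_pV2 // posrE (lt_le_trans x0).
by case: ifP => // _; exact: expR_ge0.
Qed.

Lemma box_bump_near n (a : 'rV[R]_n) (r : R) : \forall y \near a, box_bump a r y = 1.
Proof.
have cq : {for a, continuous (scaled_sqdist a r)}.
  by apply: (smooth_continuous (smooth_scaled_sqdist (A := setT) a r _)); [exact: openT|].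
have q0 : scaled_sqdist a r a = 0.
  by rewrite /scaled_sqdist big1 // => i _; rewrite subrr mul0r expr0n.
have : \forall y \near a, scaled_sqdist a r y < 1 / 4.
  apply: (cq [set z | z < 1 / 4]); rewrite /= q0; apply: lt_nbhsl.
  by rewrite divr_gt0.
apply: filterS => y qy; rewrite /box_bump [flat 1 (_ - 1 / 4)]/flat ifF.
  by rewrite subr0 divff // lt0r_neq0 // !flat1_gt0 // divr_gt0.
by apply/negbTE; rewrite -leNgt subr_le0 ltW.
Qed.

(** One coordinate at distance more than r already makes the scaled square distance at least 1. A
    box is used rather than a ball because, as a product of segments, it is compact. *)
Lemma box_bump_out n (a y : 'rV[R]_n) (r : R) : 0 < r ->
  ~ (forall i, `|y 0 i - a 0 i| <= r) -> box_bump a r y = 0.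
Proof.
move=> r0 /existsNP [i /negP]; rewrite -ltNge => yi.
rewrite /box_bump (_ : flat 1 (_ - _) = 0) ?mul0r // /flat subr_gt0 ltNge ifF //.
apply/negbF; apply: flat1_le.
have q1 : 1 <= scaled_sqdist a r y.
  rewrite /scaled_sqdist (bigD1 i) //= ler_wpDr //.
    by apply: sumr_ge0 => j _; exact: sqr_ge0.
  rewrite -real_normK ?num_real // -[1](expr1n _ 2) ler_sqr ?nnegrE //.
  by rewrite normrM normfV (gtr0_norm r0) ler_pdivlMr // mul1r ltW.
lra.
Qed.

End Bump.

(** * Cut-off functions on a manifold *)

Section Extension.
Context {R : realType} {n : nat} {N : manifold R n}.

(** V and the complement of C are open and cover W; on the second one f is 0. *)
Lemma smooth_on_glue (W V C : set N) (f : N -> R) : open W -> open V -> closed C ->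
  C `<=` V -> smooth_on (W `&` V) f -> (forall x, W x -> ~ C x -> f x = 0) -> smooth_on W f.
Proof.
move=> oW oV cC CV sf f0; apply: smooth_on_local => // x Wx.
have [Vx|nVx] := pselect (V x); first by exists V; split.
have oC : open (~` C) by exact: closed_openC.
exists (~` C); split => //; first by move/CV.
apply: eq_smooth_on (smooth_on_cst 0); first exact: openI.
by move=> y [Wy nCy]; rewrite f0.
Qed.

(** A box bump is carried to N by the preferred chart at x and extended by 0. Its support lies in
    the image C of a compact box; C is compact, hence closed since N is Hausdorff. *)
Lemma exists_bump (V : set N) x : open V -> V x ->
  exists chi : smfun (opensT N), (\forall y \near x, chi y = 1) /\
    exists C, [/\ closed C, C `<=` V & forall y, ~ C y -> chi y = 0].
Proof.
move=> oV Vx; set c := chart_at x.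
have cx : chart_dom c x := chart_at_dom x.
have oD : open (c @` (chart_dom c `&` V)) by exact: open_chart_image.
have Dx : (c @` (chart_dom c `&` V)) (c x) by exists x.
have /nbhs_ballP[e /= e0 De] := open_nbhs_nbhs (conj oD Dx).
(* Halving the radius puts the closed box K inside the open ball of radius e. *)
pose r := e / 2; have r0 : 0 < r by rewrite divr_gt0.
pose K := [set v : 'rV[R]_n | forall i, `[c x 0 i - r, c x 0 i + r]%classic (v 0 i)].
have KP v : K v <-> (forall i, `|v 0 i - c x 0 i| <= r).
  by split=> Kv i; have := Kv i; rewrite /= in_itv/= ler_distl.
have cK : compact K.
  exact: (@rV_compact R n (fun i => `[c x 0 i - r, c x 0 i + r]%classic)
    (fun i => @segment_compact _ _ _)).
have KD : K `<=` c @` (chart_dom c `&` V).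
  move=> v /KP Kv; apply: De; split=> // i j; rewrite !ord1 /ball /= distrC.
  by apply: le_lt_trans (Kv j) _; rewrite ltr_pdivrMr // ltr_pMr // ltr1n.
pose C := chart_inv c @` K.
have CV : C `<=` chart_dom c `&` V.
  by move=> _ [v /KD[y [cy Vy] <-] <-]; rewrite chart_mapK.
have cC : closed C.
  apply: compact_closed; first exact: manifold_hausdorff.
  apply: continuous_compact => //; apply: continuous_in_subspaceT => v.
  rewrite inE => /KD[y [cy _] yv]; apply: chart_inv_cont.
  by exists y.
pose f (y : N) := if y \in C then box_bump (c x) r (c y) else 0.
have fE (y : N) : chart_dom c y -> f y = box_bump (c x) r (c y).
  move=> cy; rewrite /f; case: ifPn => // /negP nCy.
  rewrite box_bump_out // => /KP Ky; apply: nCy; apply/mem_set.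
  by exists (c y) => //; rewrite chart_mapK.
have oc := @chart_dom_open _ _ _ c.
have sf : smooth_on (opensT N) f.
  apply: (smooth_on_glue (V := chart_dom c) (C := C)) => //; first exact: openT.
  - by move=> y /CV[].
  - apply: smooth_onP; first by apply: openI => //; exact: openT.
    move=> y [_ cy]; exists c, setT; split => //; [|exact: openT|].
      exact/atlas_maximal/chart_at_atlas.
    have oA : open (c @` (chart_dom c `&` ((opensT N `&` chart_dom c) `&` setT))).
      apply: open_chart_image; apply: openI; last exact: openT.
      by apply: openI => //; exact: openT.
    apply: eq_smooth (smooth_box_bump (c x) r oA) => //.
    by move=> _ [z [cz _] <-] /=; rewrite chart_mapK // fE.
  - by move=> y _ nCy; rewrite /f memNset.
exists (@SmFun _ _ _ (opensT N) f sf (fun y nT => False_ind _ (nT I))); split; last first.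
  exists C; split=> // [y /CV[]//|y nCy].
  by rewrite /= /f memNset.
have := chart_map_cont cx (box_bump_near (c x) r).
have := open_nbhs_nbhs (conj oc cx).
by apply: filterS2 => y cy; rewrite /= fE.
Qed.

End Extension.

(** * Extension of germs *)

Section Germs.
Context {R : realType} {n p : nat} {N : manifold R n} {F : vbundle N p}.

Lemma extend_smfun (V : set N) (f : N -> R) x : open V -> V x -> smooth_on V f ->
  exists g : smfun (opensT N), \forall y \near x, g y = f y.
Proof.
move=> oV Vx sf; have [chi [chi1 [C [cC CV chi0]]]] := exists_bump oV Vx.
have sg : smooth_on (opensT N) (chi \* f).
  apply: (smooth_on_glue (V := V) (C := C)) => //; first exact: openT.
    have oI : open (opensT N `&` V) by apply: openI => //; exact: openT.
    apply: smooth_onM => //; last by apply: smooth_on_sub sf => y [].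
    by apply: smooth_on_sub (smfun_smooth chi).
  by move=> y _ nCy; rewrite /= chi0 // mul0r.
exists (@SmFun _ _ _ (opensT N) _ sg (fun y nT => False_ind _ (nT I))).
by apply: filterS chi1 => y; rewrite /= => ->; rewrite mul1r.
Qed.

Lemma extend_section (V : set N) (s : forall x, F x) x : open V -> V x -> smooth_section V s ->
  exists u : sections F (opensT N), \forall y \near x, u y = s y.
Proof.
move=> oV Vx ss; have [chi [chi1 [C [cC CV chi0]]]] := exists_bump oV Vx.
have su : smooth_section (opensT N) (fun y => chi y *: s y).
  move=> tr ttr k.
  have otr : open (opensT N `&` triv_dom tr).
    by apply: openI; [exact: openT|exact: opens_open].
  apply: (smooth_on_glue (V := V) (C := C)) => //.
    have oI : open (opensT N `&` triv_dom tr `&` V) by exact: openI.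
    apply: (@eq_smooth_on _ _ _ _ (chi \* (fun y => triv_map tr y (s y) 0 k))) => //.
      by move=> y _; rewrite /= linearZ mxE.
    apply: smooth_onM => //; first by apply: smooth_on_sub (smfun_smooth chi).
    by apply: smooth_on_sub (ss tr ttr k) => y [[_ ?] ?].
  by move=> y _ nCy; rewrite /= chi0 // scale0r linear0 mxE.
exists (@Sections _ _ _ _ _ (opensT N) _ su (fun y nT => False_ind _ (nT I))).
by apply: filterS chi1 => y; rewrite /= => ->; rewrite scale1r.
Qed.

Lemma section_sumE (U : opens N) I (r : seq I) (s : I -> sections F U) x :
  (\sum_(i <- r) s i) x = \sum_(i <- r) s i x.
Proof. exact: (big_morph (fun s : sections F U => s x)). Qed.

Lemma smfun_sumE (U : opens N) I (r : seq I) (f : I -> smfun U) x :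
  (\sum_(i <- r) f i) x = \sum_(i <- r) f i x.
Proof. by apply: (big_morph (fun f : smfun U => f x)) => //; exact: smfun_0E. Qed.

Variable U : opens N.

Definition smfun_res (f : smfun (opensT N)) : smfun U :=
  smfun_restrict (smooth_on_sub (@subsetT _ U) (smfun_smooth f)).

Lemma smfun_resE f x : U x -> smfun_res f x = f x.
Proof. by move=> Ux; rewrite /= patchE mem_set. Qed.

Definition section_res (u : sections F (opensT N)) : sections F U.
Proof.
apply: (@Sections _ _ _ _ _ U (fun x => if x \in opens_set U then u x else 0)).
  move=> tr ttr k.
  have oI : open (U `&` triv_dom tr) by apply: openI; exact: opens_open.
  apply: (@eq_smooth_on _ _ _ _ (fun x => triv_map tr x (u x) 0 k)) => //.
    by move=> x [Ux _]; rewrite mem_set.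
  by apply: smooth_on_sub (section_smooth u ttr k) => x [].
by move=> x nUx; rewrite memNset.
Defined.

Lemma section_resE u x : U x -> section_res u x = u x.
Proof. by move=> Ux; rewrite /= mem_set. Qed.

Lemma near_opens x : U x -> \forall y \near x, U y.
Proof. by move=> Ux; apply: open_nbhs_nbhs; split => //; exact: opens_open. Qed.

Lemma section_extend (s : sections F U) x : U x ->
  exists u : sections F (opensT N), agree_near u s x.
Proof.
by move=> Ux; apply: extend_section (opens_open U) Ux (@section_smooth _ _ _ _ _ U s).
Qed.

Lemma smfun_extend (f : smfun U) x : U x ->
  exists g : smfun (opensT N), \forall y \near x, g y = f y.
Proof. by move=> Ux; apply: extend_smfun (opens_open U) Ux (smfun_smooth f). Qed.

Lemma smooth_triv_inv tr k : trivs tr ->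
  smooth_section (triv_dom tr) (fun y => triv_inv tr y 'e_k : F y).
Proof. by move=> ttr tr' ttr' j; exact: trivs_smooth. Qed.

(** The frame of a trivialization around x and the components of s in it are extended from their
    germs. Being global, they can be restricted to U and fed to forms over U. *)
Lemma germ_frame x : exists e : 'I_p -> sections F (opensT N),
  forall s : sections F U, U x ->
  exists2 g : 'I_p -> smfun (opensT N),
    \forall y \near x, s y = \sum_i g i y *: e i y & s x = 0 -> forall i, g i x = 0.
Proof.
have [tr ttr trx] := trivs_cover F x.
have /choice[e eE] k := extend_section (opens_open _) trx (smooth_triv_inv k ttr).
exists e => s Ux.
have oI : open (U `&` triv_dom tr) by apply: openI; exact: opens_open.
have /choice[g gE] k := extend_smfun oI (conj Ux trx) (section_smooth s ttr k).
exists g; last by move=> sx0 k; rewrite (nbhs_singleton (gE k)) sx0 linear0 mxE.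
have ge : \forall y \near x, forall k,
    e k y = triv_inv tr y 'e_k /\ g k y = triv_map tr y (s y) 0 k.
  by apply: filter_forall => k; apply: filterS2 (eE k) (gE k).
apply: filterS2 (open_nbhs_nbhs (conj (opens_open _) trx)) ge => y try ge.
rewrite -[LHS](triv_mapK try) (triv_invE _ try); apply: eq_bigr => k _.
by have [-> ->] := ge k.
Qed.

Lemma section_through x (v : F x) : exists u : sections F (opensT N), u x = v.
Proof.
have [tr ttr trx] := trivs_cover F x.
have /choice[e eE] k := extend_section (opens_open _) trx (smooth_triv_inv k ttr).
exists (\sum_k smfun_cst _ (triv_map tr x v 0 k) *: e k).
rewrite section_sumE -[RHS](triv_mapK trx) (triv_invE _ trx); apply: eq_bigr => k _.
by rewrite section_scaleE smfun_cstE mem_set // (nbhs_singleton (eE k)).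
Qed.

(** Take f = 1 - chi, with chi a bump at x supported where s vanishes. Vanishing near x becomes a
    factor vanishing at x, so operators that are linear over functions or obey Leibniz's rule are
    local. *)
Lemma section_cutoff (s : sections F U) x : U x -> (\forall y \near x, s y = 0) ->
  exists2 f : smfun U, f x = 0 & f *: s = s.
Proof.
move=> Ux s0; have : nbhs x [set y | s y = 0] by [].
rewrite nbhsE => -[V [oV Vx] Vs].
have [chi [chi1 [C [cC CV chi0]]]] := exists_bump oV Vx.
exists (1 - smfun_res chi).
  by rewrite smfun_addE smfun_oppE smfun_oneE // smfun_resE // (nbhs_singleton chi1) subrr.
apply: sectionP => y; rewrite section_scaleE.
have [Uy|nUy] := pselect (U y); last by rewrite section_out // scaler0.
have [Cy|nCy] := pselect (C y); first by rewrite Vs ?scaler0 //; exact: CV.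
by rewrite smfun_addE smfun_oppE smfun_oneE // smfun_resE // chi0 // subr0 scale1r.
Qed.

End Germs.

(** * Vector fields as derivations, and gluing of sections *)

Section VectorFields.
Context {R : realType} {n : nat} {N : manifold R n}.
Implicit Types U W : opens N.

Lemma near_chart_inv (c : chart R N n) x (P : set N) : chart_dom c x ->
  (\forall y \near x, P y) -> \forall z \near c x, P (chart_inv c z).
Proof.
move=> cx Px; have cxI : (c @` chart_dom c) (c x) by exists x.
by apply: (chart_inv_cont cxI); rewrite /= chart_mapK.
Qed.

Lemma smfun_differentiable U (f : smfun U) x : U x ->
  differentiable (f \o chart_inv (chart_at x)) (chart_at x x).
Proof.
move=> Ux; apply: smooth_differentiable (smfun_smooth f (chart_at_atlas x)) _.
by exists x => //; split=> //; exact: chart_at_dom.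
Qed.

(** The two open sets may differ, which allows local and global objects to be compared. *)
Lemma vfield_act_near U W (X : sections (tangent_bundle N) U)
    (Y : sections (tangent_bundle N) W) (f : smfun U) (g : smfun W) x : U x ->
  X x = Y x -> (\forall y \near x, f y = g y) -> vfield_act X f x = vfield_act Y g x.
Proof.
move=> Ux XY fg; rewrite /= XY.
have [_ E] := near_eq_diff (near_chart_inv (chart_at_dom x) fg) (smfun_differentiable f Ux).
exact: (esym (congr1 (fun h => h (Y x)) E)).
Qed.

Lemma vfield_actDl U (X Y : sections (tangent_bundle N) U) f :
  vfield_act (X + Y) f = vfield_act X f + vfield_act Y f.
Proof. by apply: smfunP => x; rewrite smfun_addE /= linearD. Qed.

Lemma vfield_actZl U (X : sections (tangent_bundle N) U) g f :
  vfield_act (g *: X) f = g * vfield_act X f.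
Proof. by apply: smfunP => x; rewrite smfun_mulE /= linearZ. Qed.

(** The test functions are global extensions of the germs of the preferred coordinates at x; X
    applied to the i-th one is its i-th component. *)
Lemma vfield_eq0 (X : sections (tangent_bundle N) (opensT N)) x :
  (forall g, vfield_act X g x = 0) -> X x = 0.
Proof.
move=> X0; set c := chart_at x; have cx : chart_dom c x := chart_at_dom x.
have ac : atlas c := chart_at_atlas x.
suff Xi i : (X x : 'rV[R]_n) 0 i = 0 by apply/rowP => i; rewrite Xi mxE.
have sc : smooth_on (chart_dom c) (fun y => c y 0 i).
  by move=> d ad; exact: (atlas_smooth ad ac).
have [g gc] := extend_smfun (@chart_dom_open _ _ _ c) cx sc.
have := X0 g; rewrite /= -/c => <-.
rewrite -(derive_coord (c x) (X x)) deriveE; last exact: differentiable_coord.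
have near_eq : \forall z \near c x, (z : 'rV[R]_n) 0 i = (g \o chart_inv c) z.
  have cxI : (c @` chart_dom c) (c x) by exists x.
  have := open_nbhs_nbhs (conj (@chart_img_open _ _ _ c) cxI).
  apply: filterS2 (near_chart_inv cx gc) => _ /= -> [y cy <-].
  by rewrite chart_mapK.
have [_ E] := near_eq_diff near_eq (differentiable_coord _ _ _).
exact: (esym (congr1 (fun h => h (X x)) E)).
Qed.

(** [vfield_act] differentiates in the preferred chart [d] at x. [diff_chart_inv] moves the
    computation to c, where the vector is ['e_j] and the function a linear coordinate. *)
Lemma coord_vfield_act (c : chart R N n) (mc : maximal_atlas N c) j i :
  vfield_act (coord_vfield mc j) (coord_fun mc i) = (j == i)%:R.
Proof.
apply: smfunP => x.
have [cx|ncx] := pselect (chart_dom c x); last by rewrite !smfun_out.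
set d := chart_at x; have dx : chart_dom d x := chart_at_dom x.
have [t t'] := mc _ (chart_at_atlas x).
have near_eq : \forall z \near c x, (z : 'rV[R]_n) 0 i = (coord_fun mc i \o chart_inv c) z.
  have cxI : (c @` chart_dom c) (c x) by exists x.
  have := open_nbhs_nbhs (conj (@chart_img_open _ _ _ c) cxI).
  apply: filterS => _ [y cy <-].
  by rewrite /= chart_mapK // patchE mem_set.
have [df E] := near_eq_diff near_eq (differentiable_coord _ _ _).
rewrite /= mem_set // -/d.
rewrite -(diff_chart_inv _ cx dx df); last exact: transition_differentiable.
rewrite coord_changeK // E -deriveE; last exact: differentiable_coord.
rewrite derive_coord mxE eqxx /= eq_sym.
by case: eqP => _; rewrite ?smfun_0E ?smfun_oneE.
Qed.

Lemma section_glue q (E : vbundle N q) U (s : forall x, E x) :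
  (forall x, U x -> exists w : sections E (opensT N), \forall y \near x, s y = w y) ->
  smooth_section U s.
Proof.
move=> H tr ttr k; have oI : open (U `&` triv_dom tr) by apply: openI; exact: opens_open.
apply: smooth_on_local => // x [Ux trx]; have [w] := H x Ux.
rewrite /prop_near1 nbhsE => -[V [oV Vx] Vw]; exists V; split => //.
apply: (@eq_smooth_on _ _ _ _ (fun y => triv_map tr y (w y) 0 k)); first exact: openI.
  by move=> y [_ /Vw ->].
by apply: smooth_on_sub (section_smooth w ttr k) => y [[]].
Qed.

Lemma section_oppE q (E : vbundle N q) U (s : sections E U) x : (- s) x = - s x.
Proof. by apply/eqP; rewrite -addr_eq0 -section_addE addNr. Qed.

End VectorFields.

(** * Locality of the bracket and of the anchor *)

Section LocalOperators.
Context {R : realType} {m n p : nat} {M : manifold R m} {N : manifold R n}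
  {F : vbundle N p} (G : gen_lie_algebroid M F).
Implicit Types (u v w : sections F (opensT N)).

Lemma bracketBr u v w : bracket G u (v - w) = bracket G u v - bracket G u w.
Proof.
have oppE (s : sections F (opensT N)) : smfun_cst _ (-1) *: s = - s.
  by apply: sectionP => x; rewrite section_scaleE smfun_cstE mem_set // scaleN1r section_oppE.
by rewrite addrC -oppE bracket_linearr oppE addrC.
Qed.

(** Write v = f v with f(x) = 0: in Leibniz's rule the first term vanishes at x through f, the
    second through v. *)
Lemma bracket_near0 u v x : (\forall y \near x, v y = 0) -> bracket G u v x = 0.
Proof.
move=> v0; have [f fx fv] := section_cutoff (U := opensT N) I v0.
rewrite -fv bracket_leibniz section_addE !section_scaleE fx scale0r.
by rewrite (nbhs_singleton v0) scaler0 addr0.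
Qed.

Lemma bracket_nearr u v w x : (\forall y \near x, v y = w y) ->
  bracket G u v x = bracket G u w x.
Proof.
move=> vw; apply/eqP; rewrite -subr_eq0 -section_oppE -section_addE -bracketBr.
rewrite bracket_near0 //; apply: filterS vw => y vw.
by rewrite section_addE section_oppE vw subrr.
Qed.

Lemma bracket_near u u' v v' x : (\forall y \near x, u y = u' y) ->
  (\forall y \near x, v y = v' y) -> bracket G u v x = bracket G u' v' x.
Proof.
move=> uu' /bracket_nearr ->.
by rewrite bracket_antisym [in RHS]bracket_antisym !section_oppE (bracket_nearr v' uu').
Qed.

Let phi := diffeo_comp (gla_h G) (gla_eta G).

(** [bmor_push] reads u at phi^-1 x only, so this says nothing yet about the dependence on u at
    x. *)
Lemma anchor_base u v x : u (diffeo_inv phi x) = v (diffeo_inv phi x) ->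
  anchor G u x = anchor G v x.
Proof. by rewrite /phi => E; rewrite /anchor /anchor_op /= E. Qed.

Lemma anchor_cstZD (a : R) u v x : 
  anchor G (smfun_cst _ a *: u + v) x = a *: anchor G u x + anchor G v x.
Proof. by rewrite /anchor anchor_linear section_addE section_scaleE smfun_cstE mem_set. Qed.

Lemma anchor0 x : anchor G 0 x = 0.
Proof.
have := anchor_cstZD (-1) 0 0 x.
by rewrite scaler0 addr0 scaleN1r addNr.
Qed.

(** Rank 0 is set apart because [anchor_near0] cancels a non-zero vector of the fibre. *)
Lemma rank0_fiber x (v : F x) : p = 0%N -> v = 0.
Proof.
move=> p0; have [tr ttr trx] := trivs_cover F x.
rewrite -[v](triv_mapK trx) (triv_invE _ trx) big1 // => i.
by have := ltn_ord i; rewrite [X in (_ < X)%N]p0 ltn0.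
Qed.

Lemma nonzero_vector x : (0 < p)%N -> exists v : F x, v <> 0.
Proof.
move=> p0; have [tr ttr trx] := trivs_cover F x.
exists (triv_inv tr x 'e_(Ordinal p0)) => v0.
have := triv_invK trx 'e_(Ordinal p0); rewrite v0 linear0.
by move=> /rowP/(_ (Ordinal p0)); rewrite !mxE !eqxx => /eqP; rewrite eq_sym oner_eq0.
Qed.

(* The brackets of u with v and with f v vanish at x, so Leibniz's rule leaves
   ((anchor u) f) v = 0 at x. *)
Lemma anchor_near0 u x : (\forall y \near x, u y = 0) -> anchor G u x = 0.
Proof.
move=> u0; have [p0|p0] := posnP p.
  by rewrite -(anchor0 x); apply: anchor_base; rewrite [LHS](rank0_fiber _ p0).
apply: vfield_eq0 => f.
have [v0 v0N] := nonzero_vector x p0; have [v vx] := section_through v0.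
have br0 w : bracket G u w x = 0.
  by rewrite bracket_antisym section_oppE bracket_near0 // oppr0.
have := br0 (f *: v); rewrite bracket_leibniz section_addE !section_scaleE br0 scaler0 add0r.
by rewrite vx => /eqP; rewrite scaler_eq0 => /orP[/eqP//|/eqP].
Qed.

(* If phi^-1 x is not x, u can be cut off near x without changing its value at
   phi^-1 x, the only one that the anchor uses at x. *)
Lemma anchor_pointwise0 u x : u x = 0 -> anchor G u x = 0.
Proof.
move=> ux0; set x' := diffeo_inv phi x.
have [E|/eqP xx'] := eqVneq x' x.
  rewrite -(anchor0 x); apply: anchor_base; rewrite -/x' E; exact: ux0.
have oV : open (~` [set x']).
  apply: closed_openC; apply: accessible_closed_set1.
  exact/hausdorff_accessible/manifold_hausdorff.
have [chi [chi1 [C [cC CV chi0]]]] := exists_bump oV (fun e => xx' (esym e)).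
have chix' : chi x' = 0 by apply: chi0 => /CV; exact.
pose u' := u - chi *: u.
rewrite (anchor_base (v := u')); last first.
  by rewrite -/x' section_addE section_oppE section_scaleE chix' scale0r subr0.
apply: anchor_near0; apply: filterS chi1 => y chiy.
by rewrite section_addE section_oppE section_scaleE chiy scale1r subrr.
Qed.

Lemma anchor_pointwise u v x : u x = v x -> anchor G u x = anchor G v x.
Proof.
move=> uv; apply/eqP; rewrite -subr_eq0 addrC -scaleN1r -anchor_cstZD.
rewrite anchor_pointwise0 // section_addE section_scaleE smfun_cstE mem_set //.
by rewrite uv scaleN1r addNr.
Qed.

(** * The anchor and the bracket over an open set *)

Context {U : opens N}.
Implicit Types (s t : sections F U) (f : smfun U).

(** [xget] returns 0 unless its specification can be met, so a section meeting it has to be built.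
    Choosing an extension at each point gives one; it is smooth since near y it coincides with the
    anchor of the single extension [e y]. *)
Lemma local_anchor_agree s x u : U x -> agree_near u s x ->
  local_anchor G s x = anchor G u x.
Proof.
move=> Ux us; rewrite /local_anchor; case: xgetP => [X _|none]; first exact.
have /choice[e eE] y : exists u, U y -> agree_near u s y.
  have [Uy|nUy] := pselect (U y); last by exists 0.
  by have [v] := section_extend s Uy; exists v.
pose X0 y := if y \in opens_set U then anchor G (e y) y else 0.
have sX : smooth_section U (X0 : forall y, tangent_bundle N y).
  apply: section_glue => y Uy; exists (anchor G (e y)).
  apply: filterS2 (near_opens Uy) (eE y Uy) => z Uz ez.
  by rewrite /X0 mem_set //; apply: anchor_pointwise; rewrite ez (nbhs_singleton (eE z Uz)).
pose X := @Sections _ _ _ _ _ U _ sX (fun y nUy => ifN _ _ (introN idP (fun h => nUy (set_mem h)))).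
case: (none X) => y Uy w ws.
rewrite /= /X0 mem_set //; apply: anchor_pointwise.
by rewrite (nbhs_singleton (eE y Uy)) (nbhs_singleton ws).
Qed.

Lemma local_anchor_pointwise s x u : U x -> u x = s x -> local_anchor G s x = anchor G u x.
Proof.
move=> Ux us; have [v vs] := section_extend s Ux.
rewrite (local_anchor_agree Ux vs); apply: anchor_pointwise.
by rewrite us (nbhs_singleton vs).
Qed.

Lemma local_anchor_linear f s t :
  local_anchor G (f *: s + t) = f *: local_anchor G s + local_anchor G t.
Proof.
apply: sectionP => x; have [Ux|nUx] := pselect (U x); last by rewrite !section_out.
have [u us] := section_extend s Ux; have [v vt] := section_extend t Ux.
rewrite section_addE section_scaleE (local_anchor_agree Ux us) (local_anchor_agree Ux vt).
(* Only the value at x matters, so f may be replaced by the constant f(x): real linearity becomes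
   linearity over functions. *)
rewrite -anchor_cstZD; apply: local_anchor_pointwise => //.
rewrite section_addE section_scaleE smfun_cstE mem_set //.
by rewrite section_addE section_scaleE (nbhs_singleton us) (nbhs_singleton vt).
Qed.

Lemma local_bracket_agree s t x u v : U x -> agree_near u s x -> agree_near v t x ->
  local_bracket G s t x = bracket G u v x.
Proof.
move=> Ux us vt; rewrite /local_bracket; case: xgetP => [w _|none]; first exact.
have /choice[e eE] y : exists e, U y -> agree_near e.1 s y /\ agree_near e.2 t y.
  have [Uy|nUy] := pselect (U y); last by exists (0, 0).
  have [a sa] := section_extend s Uy; have [b tb] := section_extend t Uy.
  by exists (a, b).
have nearE y z a b : agree_near a s y -> agree_near b t y -> 
    agree_near (e z).1 s y -> agree_near (e z).2 t y ->
    bracket G (e z).1 (e z).2 y = bracket G a b y.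
  move=> sa tb ea eb; apply: bracket_near.
    by apply: filterS2 ea sa => q -> ->.
  by apply: filterS2 eb tb => q -> ->.
pose w0 y := if y \in opens_set U then bracket G (e y).1 (e y).2 y else 0.
have sw : smooth_section U w0.
  apply: section_glue => y Uy; exists (bracket G (e y).1 (e y).2).
  (* The bracket depends on germs, not on values: the extensions chosen at y must agree with s and t
     near each z close to y. *)
  have [/nbhs_interior ea /nbhs_interior eb] := eE y Uy.
  move: (near_opens Uy) ea eb; apply: filterS3 => z Uz ea eb.
  have [ez1 ez2] := eE z Uz.
  by rewrite /w0 mem_set //; apply: nearE.
pose w := @Sections _ _ _ _ _ U _ sw (fun y nUy => ifN _ _ (introN idP (fun h => nUy (set_mem h)))).
case: (none w) => y Uy a b sa tb; have [e1 e2] := eE y Uy.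
by rewrite /= /w0 mem_set //; apply: nearE.
Qed.

Lemma local_bracket_antisym s t : local_bracket G s t = - local_bracket G t s.
Proof.
apply: sectionP => x; have [Ux|nUx] := pselect (U x); last by rewrite !section_out.
have [u us] := section_extend s Ux; have [v vt] := section_extend t Ux.
rewrite section_oppE (local_bracket_agree Ux us vt) (local_bracket_agree Ux vt us).
by rewrite bracket_antisym section_oppE.
Qed.

Lemma local_bracketDr s t t' :
  local_bracket G s (t + t') = local_bracket G s t + local_bracket G s t'.
Proof.
apply: sectionP => x; have [Ux|nUx] := pselect (U x); last by rewrite !section_out.
have [u us] := section_extend s Ux.
have [v vt] := section_extend t Ux; have [v' vt'] := section_extend t' Ux.
rewrite section_addE (local_bracket_agree Ux us vt) (local_bracket_agree Ux us vt').
(* This is v + v' written with differences only, so that [bracketBr] applies. *)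
rewrite (@local_bracket_agree _ _ _ u (v - (v' - v' - v'))) //.
  by rewrite !bracketBr subrr sub0r opprK section_addE.
apply: filterS2 vt vt' => y vy v'y.
by rewrite subrr sub0r opprK !section_addE vy v'y.
Qed.

Lemma local_bracket_leibniz s t f :
  local_bracket G s (f *: t) =
    f *: local_bracket G s t + vfield_act (local_anchor G s) f *: t.
Proof.
apply: sectionP => x; have [Ux|nUx] := pselect (U x); last by rewrite !section_out.
have [u us] := section_extend s Ux; have [v vt] := section_extend t Ux.
have [g gf] := smfun_extend f Ux.
rewrite (@local_bracket_agree _ _ _ u (g *: v)) //; last first.
  by apply: filterS2 gf vt => y gy vy; rewrite !section_scaleE gy vy.
rewrite bracket_leibniz !section_addE !section_scaleE (local_bracket_agree Ux us vt).
rewrite (nbhs_singleton gf) (nbhs_singleton vt); congr (_ + _ *: _).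
by apply: vfield_act_near => //; rewrite (local_anchor_agree Ux us).
Qed.

End LocalOperators.

(** * Structure equations *)

Section Forms.
Context {R : realType} {m n p : nat} {M : manifold R m} {N : manifold R n}
  {F : vbundle N p} (G : gen_lie_algebroid M F) {U : opens N}.
Implicit Types (s t : sections F U) (f : smfun U) (w : ext_form F U 1).

Lemma linear_comb (A : pzRingType) (V W : lmodType A) (phi : V -> W) I (r : seq I)
    (c : I -> A) (v : I -> V) : linear phi ->
  phi (\sum_(i <- r) c i *: v i) = \sum_(i <- r) c i *: phi (v i).
Proof.
move=> lphi; elim: r => [|i r IH]; last by rewrite !big_cons lphi IH.
by have := lphi (-1) 0 0; rewrite !big_nil scaler0 addr0 scaleN1r addNr.
Qed.

Definition form1 w s : smfun U := w (fun=> s).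

Lemma form1_linear w f s t : form1 w (f *: s + t) = f * form1 w s + form1 w t.
Proof.
have := ext_form_linear w (fun=> 0) ord0 f s t.
have E (u : sections F U) : [eta (fun=> 0) with ord0 |-> u] = (fun=> u) :> ('I_1 -> _).
  by apply/funext => i; rewrite /= ord1.
by rewrite !E.
Qed.

Lemma form1D w s t : form1 w (s + t) = form1 w s + form1 w t.
Proof. by have := form1_linear w 1 s t; rewrite scale1r mul1r. Qed.

Lemma form1_0 w : form1 w 0 = 0.
Proof. by apply: (addIr (form1 w 0)); rewrite -form1D addr0 add0r. Qed.

Lemma form1Z w f s : form1 w (f *: s) = f * form1 w s.
Proof. by rewrite -[X in form1 w X]addr0 form1_linear form1_0 addr0. Qed.

Lemma form1N w s : form1 w (- s) = - form1 w s.
Proof. by rewrite -scaleN1r form1Z mulN1r. Qed.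

Lemma form1_sum w I (r : seq I) (s : I -> sections F U) :
  form1 w (\sum_(i <- r) s i) = \sum_(i <- r) form1 w (s i).
Proof.
exact: (big_morph (form1 w) (form1D w) (form1_0 w)).
Qed.

Lemma form1_near0 w s x : U x -> (\forall y \near x, s y = 0) -> form1 w s x = 0.
Proof.
move=> Ux /(section_cutoff Ux)[f fx <-].
by rewrite form1Z smfun_mulE fx mul0r.
Qed.

(** Near x, s equals a combination s' of sections whose coefficients vanish at x. Linearity handles
    s', and s - s' vanishes near x. *)
Lemma form1_pointwise0 w s x : U x -> s x = 0 -> form1 w s x = 0.
Proof.
move=> Ux sx0; have [e /(_ s Ux)[g sE /(_ sx0) gx0]] := germ_frame (F := F) U x.
pose s' := \sum_i smfun_res U (g i) *: section_res U (e i).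
have s'0 : form1 w s' x = 0.
  rewrite form1_sum smfun_sumE big1 // => i _.
  by rewrite form1Z smfun_mulE smfun_resE // gx0 mul0r.
have -> : s = s' + (s - s') by rewrite addrC subrK.
rewrite form1D smfun_addE s'0 add0r form1_near0 //.
apply: filterS2 (near_opens Ux) sE => y Uy sy.
rewrite section_addE section_oppE section_sumE sy.
apply/eqP; rewrite subr_eq0; apply/eqP; apply: eq_bigr => i _.
by rewrite section_scaleE smfun_resE // section_resE.
Qed.

(** * Expansion of a section in a frame *)

Section Coframe.
Variables (t : 'I_p -> sections F U) (tau : 'I_p -> ext_form F U 1).
Hypothesis t_frame : is_frame t.
Hypothesis tau_coframe : forall a b, tau a (fun=> t b) = (a == b)%:R.

Lemma form1_comb b (c : 'I_p -> smfun U) : form1 (tau b) (\sum_a c a *: t a) = c b.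
Proof.
rewrite form1_sum (bigD1 b) //= big1 => [|a ab]; last first.
  by rewrite form1Z /form1 tau_coframe eq_sym (negbTE ab) mulr0.
by rewrite form1Z /form1 tau_coframe eqxx addr0 mulr1.
Qed.

(** The frame coefficients of s are not known to be smooth, so they are frozen at x: s' has constant
    coefficients and the same value at x, which is all that a 1-form sees. *)
Lemma coframe_expand s : s = \sum_a form1 (tau a) s *: t a.
Proof.
apply: sectionP => x; have [Ux|nUx] := pselect (U x); last by rewrite !section_out.
have [a [sx _]] := t_frame Ux (s x).
pose s' := \sum_b smfun_cst U (a 0 b) *: t b.
have s'x : s' x = s x.
  rewrite section_sumE sx; apply: eq_bigr => b _.
  by rewrite section_scaleE smfun_cstE mem_set.
rewrite section_sumE sx; apply: eq_bigr => b _; rewrite section_scaleE; congr (_ *: _).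
have : form1 (tau b) (- s' + s) x = 0.
  by apply: form1_pointwise0; rewrite // section_addE section_oppE s'x addNr.
rewrite form1D form1N smfun_addE smfun_oppE form1_comb smfun_cstE mem_set //.
by move/eqP; rewrite addrC subr_eq0 => /eqP.
Qed.

End Coframe.

Lemma local_bracket_comb s (c : 'I_p -> smfun U) (t : 'I_p -> sections F U) :
  local_bracket G s (\sum_b c b *: t b) =
  \sum_b (c b *: local_bracket G s (t b) + vfield_act (local_anchor G s) (c b) *: t b).
Proof.
have br0 : local_bracket G s 0 = 0.
  by apply: (addIr (local_bracket G s 0)); rewrite -local_bracketDr addr0 add0r.
rewrite (big_morph (local_bracket G s) (local_bracketDr G s) br0).
by apply: eq_bigr => b _; rewrite local_bracket_leibniz.
Qed.

Lemma vfield_act_comb (X : 'I_p -> sections (tangent_bundle N) U) (c : 'I_p -> smfun U) f :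
  vfield_act (\sum_b c b *: X b) f = \sum_b c b * vfield_act (X b) f.
Proof.
have act0 : vfield_act (0 : sections (tangent_bundle N) U) f = 0.
  by rewrite -(scale0r 0) vfield_actZl mul0r.
rewrite (big_morph (fun X => vfield_act X f) (fun X Y => vfield_actDl X Y f) act0).
by apply: eq_bigr => b _; rewrite vfield_actZl.
Qed.

(** * Wedge product and exterior derivative of 1-forms *)

Lemma perm2_cases (sigma : 'S_2) : sigma = 1%g \/ sigma = tperm ord0 ord_max.
Proof.
have I2 (i : 'I_2) : i = ord0 \/ i = ord_max.
  by case: i => [[|[|//]] H]; [left|right]; apply: val_inj.
have s01 : sigma ord0 <> sigma ord_max by move/perm_inj.
case: (I2 (sigma ord0)) (I2 (sigma ord_max)) => E0 [E1|E1].
- by case: s01; rewrite E0 E1.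
- by left; apply/permP => i; rewrite perm1; case: (I2 i) => ->.
- by right; apply/permP => i; case: (I2 i) => ->; rewrite ?tpermL ?tpermR.
- by case: s01; rewrite E0 E1.
Qed.

Lemma ext_prod11 w w' z : ext_prod w w' z =
  form1 w (z ord0) * form1 w' (z ord_max) - form1 w (z ord_max) * form1 w' (z ord0).
Proof.
have E1 (x : ext_form F U 1) (h : 'I_1 -> 'I_2) : x (fun k => z (h k)) = form1 x (z (h ord0)).
  by congr (x _); apply/funext => k; rewrite ord1.
rewrite /ext_prod (_ : _^-1 = 1) ?invr1 // mul1r.
rewrite (bigD1 1%g) //= (bigD1 (tperm ord0 ord_max)) /=; last first.
  by apply/eqP => /permP/(_ ord0); rewrite tpermL perm1.
rewrite big1 ?addr0 => [|sigma /andP[]]; last first.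
  by case: (perm2_cases sigma) => ->; rewrite eqxx.
rewrite odd_perm1 odd_tperm expr0 mul1r expr1 mulN1r.
have l0 : lshift 1 (ord0 : 'I_1) = ord0 by exact: val_inj.
have r0 : rshift 1 (ord0 : 'I_1) = ord_max by exact: val_inj.
rewrite !E1.
by rewrite l0 r0 !perm1 tpermL tpermR.
Qed.

Lemma exterior_d1 w z : exterior_d G w z =
  vfield_act (local_anchor G (z ord0)) (form1 w (z ord_max)) -
  vfield_act (local_anchor G (z ord_max)) (form1 w (z ord0)) -
  form1 w (local_bracket G (z ord0) (z ord_max)).
Proof.
rewrite /exterior_d !big_ord_recl !big_ord0 /= !addr0.
have E1 (h : 'I_1 -> sections F U) : w h = form1 w (h ord0).
  by congr (w _); apply/funext => k; rewrite ord1.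
have l0 : lift ord0 (ord0 : 'I_1) = ord_max :> 'I_2 by exact: val_inj.
have l1 : lift ord_max (ord0 : 'I_1) = ord0 :> 'I_2 by exact: val_inj.
rewrite !big_mkcond !big_ord_recl !big_ord0 /= !E1 /= !l0 l1 !addr0 !add0r.
rewrite /bump /= addn0 add0n big_pred0 => [|j]; last by rewrite ltnNge -ltnS ltn_ord.
by rewrite expr0 mul1r !expr1 !mulN1r addr0.
Qed.

End Forms.

Theorem theorem2p9 (R : realType) (m n p : nat) (M : manifold R m)
    (N : manifold R n) (F : vbundle N p) (G : gen_lie_algebroid M F)
    (kappa : chart R N n) (kappa_atlas : maximal_atlas N kappa)
    (U := chart_opens kappa)
    (t : 'I_p -> sections F U) (t_frame : is_frame t)
    (tau : 'I_p -> ext_form F U 1)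
    (tau_coframe : forall a b, tau a (fun=> t b) = (a == b)%:R)
    (L : 'I_p -> 'I_p -> 'I_p -> smfun U)
    (L_def : forall b c, local_bracket G (t b) (t c) = \sum_a L a b c *: t a)
    (theta : 'I_n -> 'I_p -> smfun U)
    (theta_def : forall a,
       local_anchor G (t a) = \sum_i theta i a *: coord_vfield kappa_atlas i) :
  (forall a z, exterior_d G (tau a) z =
     - (smfun_cst U 2^-1 * \sum_b \sum_c L a b c * ext_prod (tau b) (tau c) z)) /\
  (forall i z, exterior_d G (ext_form0 F (coord_fun kappa_atlas i)) z =
     \sum_a theta i a * tau a z).
Proof.
have expand s := coframe_expand t_frame tau_coframe s.
have comb := form1_comb tau_coframe.
have anchor_expand s :
    local_anchor G s = \sum_a form1 (tau a) s *: local_anchor G (t a).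
  by rewrite [in LHS](expand s) linear_comb //; exact: local_anchor_linear.
split=> [a z|i z]; last first.
  (* In degree 0 only the anchor term remains. It is expanded in the coframe, and the i-th
     coordinate selects the coefficient [theta i a]. *)
  rewrite /exterior_d !big_ord1 big_pred0 => [|j]; last by rewrite [j]ord1.
  rewrite expr0 mul1r addr0 anchor_expand vfield_act_comb; apply: eq_bigr => a _.
  rewrite theta_def vfield_act_comb (bigD1 i) //= big1 => [|j ji].
    rewrite coord_vfield_act eqxx mulr1 addr0 mulrC; congr (_ * _).
    by rewrite /form1; congr (tau a _); apply/funext => k; rewrite [k]ord1.
  by rewrite coord_vfield_act (negbTE ji) mulr0.
rewrite exterior_d1.
set s0 := z ord0; set s1 := z ord_max.
have L_antisym b c : L a b c = - L a c b.
  by rewrite -(comb a (fun a => L a b c)) -L_def local_bracket_antisym form1N L_def comb.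
(* The Leibniz expansion acts on the second argument, so antisymmetry brings s there; the derivative
   term appears with a minus sign. *)
have br s b : form1 (tau a) (local_bracket G s (t b)) =
    \sum_c form1 (tau c) s * L a c b - vfield_act (local_anchor G (t b)) (form1 (tau a) s).
  rewrite local_bracket_antisym form1N [X in local_bracket G _ X](expand s) local_bracket_comb.
  rewrite big_split form1D comb opprD; congr (_ - _).
  rewrite form1_sum -sumrN; apply: eq_bigr => c _.
  by rewrite form1Z L_def comb L_antisym mulrN opprK.
(* Both arguments of the bracket get expanded in the frame. The two derivative terms that arise
   cancel those of [exterior_d1], and -S is left. *)
rewrite [X in local_bracket G _ X](expand s1) local_bracket_comb big_split form1D comb.
have -> : form1 (tau a) (\sum_b form1 (tau b) s1 *: local_bracket G s0 (t b)) =
    \sum_b form1 (tau b) s1 * (\sum_c form1 (tau c) s0 * L a c b) -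
    vfield_act (local_anchor G s1) (form1 (tau a) s0).
  rewrite anchor_expand vfield_act_comb -sumrB form1_sum; apply: eq_bigr => b _.
  by rewrite form1Z br mulrBr.
set S := (X in _ - (X - _ + _)).
(* Each of the two terms of the wedge product contributes S, the second by antisymmetry of L in its
   lower indices; this accounts for the factor 1/2. *)
set T := (X in _ = - (_ * X)); have -> : T = S + S.
  transitivity (\sum_b \sum_c L a b c * (form1 (tau b) s0 * form1 (tau c) s1) +
                \sum_b \sum_c L a c b * (form1 (tau b) s1 * form1 (tau c) s0)).
    rewrite -big_split; apply: eq_bigr => b _; rewrite -big_split; apply: eq_bigr => c _.
    by rewrite ext_prod11 mulrBr; congr (_ + _); rewrite L_antisym mulNr opprK.
  congr (_ + _); last first.
    apply: eq_bigr => b _; rewrite mulr_sumr; apply: eq_bigr => c _.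
    by rewrite mulrC mulrA.
  rewrite exchange_big; apply: eq_bigr => b _; rewrite mulr_sumr; apply: eq_bigr => c _.
  by rewrite mulrC mulrA [_ * form1 _ s1]mulrC.
(* The constant 1/2 is extended by 0, so points outside U are treated apart; there S is 0 as
   well. *)
have -> : smfun_cst U 2^-1 * (S + S) = S.
  apply: smfunP => x; rewrite smfun_mulE smfun_addE smfun_cstE.
  case: ifPn => [_|/negP nUx]; last by rewrite mul0r smfun_out // => /mem_set.
  by field.
ring.
Qed.
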